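(* There exist positive constants $C$ and $\varepsilon_0$, depending on $\Gamma$ and $\mathcal{A}$, such that for all $\varepsilon\in(0,\varepsilon_0)$, $$\big\|U_\varepsilon(H_\varepsilon+1)^{-1}U_\varepsilon^{-1}-(H_0+1)^{-1}\big\|\le C\varepsilon,$$ where $\|\cdot\|$ is the operator norm of bounded operators on $L^2(\Pi)$.
   Context: Let $\mathcal{A}$ be a smooth ($C^\infty$) two-dimensional oriented Riemannian manifold with Gauss curvature $K$. Let $L>0$ and let $\Gamma:[0,L]\to\mathcal{A}$ be a smooth embedded curve parametrised by arc length, $T:=\Gamma'$ its unit tangent field, $\mathbf{N}$ the smooth unit normal field along $\Gamma$ such that $\{T,\mathbf{N}\}$ is positively oriented, and $\kappa$ the curvature of $\Gamma$ defined by $T'=\kappa\mathbf{N}$ (covariant derivative along $\Gamma$). Put $\Pi:=(0,L)\times(-1,1)$ and $\mathscr{L}_\varepsilon(s,t):=\exp_{\Gamma(s)}\big(\varepsilon\,t\,\mathbf{N}(s)\big)$. Let $K_\varepsilon:=K\circ\mathscr{L}_\varepsilon$ and let $f_\varepsilon$ be the solution, for each fixed $s\in[0,L]$ and $t\in[-1,1]$, of $$\partial_t^2f_\varepsilon(s,t)+\varepsilon^2K_\varepsilon(s,t)f_\varepsilon(s,t)=0,\qquad f_\varepsilon(s,0)=1,\qquad \partial_tf_\varepsilon(s,0)=-\varepsilon\kappa(s).$$ Only $\varepsilon>0$ so small that $f_\varepsilon$ is bounded from below by a positive constant on $\Pi$ are considered. $H_\varepsilon$ is the self-adjoint operator in $L^2(\Pi,f_\varepsilon\,\mathrm{d}s\,\mathrm{d}t)$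 associated with the closed quadratic form $h_\varepsilon[\psi]:=\int_\Pi f_\varepsilon^{-1}|\partial_s\psi|^2+\varepsilon^{-2}\int_\Pi f_\varepsilon|\partial_t\psi|^2$ (integration with respect to $\mathrm{d}s\,\mathrm{d}t$) with domain $W^{1,2}(\Pi)$. $H_0$ (which also depends on $\varepsilon$) is the self-adjoint operator in $L^2(\Pi)=L^2(\Pi,\mathrm{d}s\,\mathrm{d}t)$ associated with the closed quadratic form $h_0[\psi]:=\int_\Pi|\partial_s\psi|^2+\varepsilon^{-2}\int_\Pi|\partial_t\psi|^2$ with domain $W^{1,2}(\Pi)$. $U_\varepsilon:L^2(\Pi,f_\varepsilon\,\mathrm{d}s\,\mathrm{d}t)\to L^2(\Pi)$ is the unitary operator $\psi\mapsto f_\varepsilon^{1/2}\psi$. *)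

(* Defs.v *)
From HB Require Import structures.
From mathcomp Require Import all_boot all_order all_algebra.
From mathcomp Require Import all_classical all_reals all_analysis.
From mathcomp Require Import complex.

Set Implicit Arguments.
Unset Strict Implicit.
Unset Printing Implicit Defensive.

Import Order.TTheory GRing.Theory Num.Theory.
Import numFieldNormedType.Exports.

Local Open Scope classical_set_scope.
Local Open Scope ring_scope.
Local Open Scope complex_scope.

Section Smoothness.
Context {R : realType}.

(* Meant for U open and V, W finite-dimensional, where existence and continuity
   on U of all iterated directional derivatives of order at most k is the usual
   C^k condition. *)
Fixpoint Ck_on (k : nat) (V W : normedModType R) (U : set V) (f : V -> W)
    : Prop :=
  (forall x, U x -> {for x, continuous f}) /\
  if k is k'.+1 then
    forall v, (forall x, U x -> derivable f x v) /\ Ck_on k' U ('D_v f)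
  else True.

Definition smooth_on (V W : normedModType R) (U : set V) (f : V -> W) : Prop :=
  forall k, Ck_on k U f.

Definition partial (W : normedModType R) (a : 'I_2) (f : 'rV[R]_2 -> W)
    (x : 'rV[R]_2) : W := 'D_(delta_mx 0 a) f x.

(* Row a is the derivative of f in direction a. *)
Definition jac (f : 'rV[R]_2 -> 'rV[R]_2) (x : 'rV[R]_2) : 'M[R]_2 :=
  \matrix_(a, b) partial a f x 0 b.

(* Derivative relative to D: one-sided at the end points of an interval D. *)
Definition is_derive_within (D : set R) (f : R -> R) (x l : R) : Prop :=
  (f y - f x) / (y - x) @[y --> within (D `\ x) (nbhs x)] --> l.

End Smoothness.

(* The orientation is given by requiring all transition maps of the atlas to
   preserve it; the metric is given by its components in every chart. *)
Record oriented_surface (R : realType) := OrientedSurface {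
  carrier :> topologicalType;
  carrier_hausdorff : hausdorff_space carrier;
  carrier_second_countable : @second_countable carrier;
  chart : Type;
  cdom : chart -> set carrier;
  cmap : chart -> carrier -> 'rV[R]_2;
  cinv : chart -> 'rV[R]_2 -> carrier;
  cran := fun i => cmap i @` cdom i;
  cdom_cover : forall p, exists i, cdom i p;
  cdom_open : forall i, open (cdom i);
  cran_open : forall i, open (cran i);
  cmapK : forall i p, cdom i p -> cinv i (cmap i p) = p;
  cmap_continuous : forall i p, cdom i p -> {for p, continuous (cmap i)};
  cinv_continuous : forall i x, cran i x -> {for x, continuous (cinv i)};
  transition := fun i j => cmap j \o cinv i;
  overlap := fun i j => cmap i @` (cdom i `&` cdom j);
  transition_smooth : forall i j, smooth_on (overlap i j) (transition i j);
  transition_oriented :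
    forall i j x, overlap i j x -> 0 < \det (jac (transition i j) x);
  metric : chart -> 'rV[R]_2 -> 'M[R]_2;
  metric_smooth : forall i, smooth_on (cran i) (metric i);
  metric_sym : forall i x, cran i x -> (metric i x)^T = metric i x;
  metric_posdef : forall i x (v : 'rV[R]_2), cran i x -> v != 0 ->
    0 < (v *m metric i x *m v^T) 0 0;
  metric_transition : forall i j x, overlap i j x ->
    metric i x = jac (transition i j) x
      *m metric j (transition i j x) *m (jac (transition i j) x)^T
}.

Section Geometry.
Context {R : realType} {A : oriented_surface R}.
Implicit Types (i : chart A) (x : 'rV[R]_2) (c : R -> A).

Definition gdot i x (v w : 'rV[R]_2) : R := (v *m metric i x *m w^T) 0 0.

(* \Gamma^d_{ab} = 1/2 g^{de} (d_a g_{be} + d_b g_{ae} - d_e g_{ab}) *)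
Definition christoffel i x (d a b : 'I_2) : R :=
  2^-1 * \sum_(e < 2) invmx (metric i x) d e *
    (partial a (fun y => metric i y b e) x
     + partial b (fun y => metric i y a e) x
     - partial e (fun y => metric i y a b) x).

(* R(d_a, d_b) d_c = \sum_d (riemann d c a b) d_d, with the convention
   R(X, Y) = [nabla_X, nabla_Y] - nabla_[X, Y]. *)
Definition riemann i x (d c a b : 'I_2) : R :=
  partial a (fun y => christoffel i y d b c) x
  - partial b (fun y => christoffel i y d a c) x
  + \sum_(e < 2) (christoffel i x d a e * christoffel i x e b c
                  - christoffel i x d b e * christoffel i x e a c).

(* g(R(d_0, d_1) d_1, d_0) / det g *)
Definition gauss_chart i x : R :=
  (\sum_(d < 2) riemann i x d 1 0 1 * metric i x d 0) / \det (metric i x).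

Definition is_gauss_curvature (K : A -> R) : Prop :=
  forall i p, cdom i p -> K p = gauss_chart i (cmap i p).

Definition smooth_curve (J : set R) c : Prop :=
  (forall s, J s -> {for s, continuous c}) /\
  (forall i, smooth_on (J `&` c @^-1` cdom i) (cmap i \o c)).

(* Smoothness on a closed interval means smoothness on a neighbourhood. *)
Definition smooth_arc (a b : R) c : Prop :=
  exists J, [/\ open J, `[a, b] `<=` J & smooth_curve J c].

Definition velocity c i (s : R) : 'rV[R]_2 := derive1 (cmap i \o c) s.

(* Components of the covariant derivative of c' along c. *)
Definition cov_accel c i (s : R) : 'rV[R]_2 :=
  \row_d (derive1 (velocity c i) s 0 d
    + \sum_(a < 2) \sum_(b < 2) christoffel i (cmap i (c s)) d a b
        * velocity c i s 0 a * velocity c i s 0 b).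

(* A tangent vector at p is given by its components in every chart around p. *)
Definition tangent := chart A -> 'rV[R]_2.

Definition is_geodesic c : Prop :=
  smooth_arc 0 1 c /\
  forall t i, t \in `[0, 1] -> cdom i (c t) -> cov_accel c i t = 0.

(* q = exp_p(v); the exponential map is only partially defined, A not being
   assumed to be complete. *)
Definition is_exp (p : A) (v : tangent) (q : A) : Prop :=
  exists c, [/\ is_geodesic c, c 0 = p,
    forall i, cdom i p -> velocity c i 0 = v i & c 1 = q].

(* Embeddedness: the curve is an immersion by the unit speed condition, and an
   injective immersion of the compact interval [0, L] is an embedding. *)
Definition unit_speed_embedded (L : R) c : Prop :=
  [/\ smooth_arc 0 L c,
      forall s i, s \in `[0, L] -> cdom i (c s) ->
        gdot i (cmap i (c s)) (velocity c i s) (velocity c i s) = 1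
    & forall s t, s \in `[0, L] -> t \in `[0, L] -> c s = c t -> s = t].

Definition is_unit_normal (L : R) c (N : R -> tangent) : Prop :=
  forall s i, s \in `[0, L] -> cdom i (c s) ->
  let x := cmap i (c s) in let T := velocity c i s in
  [/\ gdot i x T (N s i) = 0, gdot i x (N s i) (N s i) = 1
    & 0 < \det (col_mx T (N s i) : 'M[R]_2)].

Definition is_curvature (L : R) c (N : R -> tangent) (kappa : R -> R) : Prop :=
  forall s i, s \in `[0, L] -> cdom i (c s) -> cov_accel c i s = kappa s *: N s i.

Definition is_strip_map (L : R) c (N : R -> tangent) (eps : R)
    (Leps : R * R -> A) : Prop :=
  forall s t, s \in `[0, L] -> t \in `[-1, 1] ->
  is_exp (c s) (fun i => (eps * t) *: N s i) (Leps (s, t)).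

End Geometry.

Section Strip.
Context {R : realType}.
Variable L : R.
Implicit Types (w a b : R * R -> R) (u v g : R * R -> R[i]).

(* The open rectangle Pi. *)
Definition strip : set (R * R) := `]0, L[ `*` `]-1, 1[.

Definition is_jacobi_solution (eps : R) (kappa : R -> R) (Keps f : R * R -> R)
    : Prop :=
  forall s, s \in `[0, L] -> exists f' : R -> R,
  [/\ forall t, t \in `[-1, 1] ->
        is_derive_within `[-1, 1]%classic (fun t => f (s, t)) t (f' t),
      forall t, t \in `[-1, 1] ->
        is_derive_within `[-1, 1]%classic f' t
          (- (eps ^+ 2 * Keps (s, t) * f (s, t))),
      f (s, 0) = 1 & f' 0 = - (eps * kappa s)].

Local Notation leb2 := (@lebesgue_measure R \x @lebesgue_measure R)%E.

Definition cintegral u : R[i] :=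
  (\int[leb2]_(x in strip) complex.Re (u x))
    +i* (\int[leb2]_(x in strip) complex.Im (u x)).

Definition inner w u v : R[i] :=
  cintegral (fun x => (w x)%:C * u x * (v x)^*).

Definition L2norm w u : \bar R :=
  ((\int[leb2]_(x in strip) (w x * Normc.normc (u x) ^+ 2)%:E) `^ 2^-1)%E.

(* L^2(Pi, w ds dt), elements being represented by functions. *)
Definition L2 w u : Prop :=
  [/\ measurable_fun strip (fun x => complex.Re (u x)),
      measurable_fun strip (fun x => complex.Im (u x)) & (L2norm w u < +oo)%E].

Definition eq_ae u v : Prop := {ae leb2, forall x, strip x -> u x = v x}.

Definition unit_weight : R * R -> R := cst 1.

Definition test_function (phi : R * R -> R) : Prop :=
  smooth_on setT phi /\
  exists K, [/\ compact K, K `<=` strip & forall x, ~ K x -> phi x = 0].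

Definition is_weak_derivative (e : R * R) u du : Prop :=
  forall phi, test_function phi ->
  cintegral (fun x => u x * ('D_e phi x)%:C)
  = - cintegral (fun x => du x * (phi x)%:C).

Definition weak_derivative (e : R * R) u : R * R -> R[i] :=
  xget (cst 0) [set du | L2 unit_weight du /\ is_weak_derivative e u du].

Definition W12 u : Prop :=
  [/\ L2 unit_weight u,
      exists2 du, L2 unit_weight du & is_weak_derivative (1, 0) u du
    & exists2 du, L2 unit_weight du & is_weak_derivative (0, 1) u du].

(* The sesquilinear form, with domain W12, of the quadratic form
   \int_Pi a |d_s u|^2 + \int_Pi b |d_t u|^2. *)
Definition form a b u v : R[i] :=
  inner a (weak_derivative (1, 0) u) (weak_derivative (1, 0) v)
  + inner b (weak_derivative (0, 1) u) (weak_derivative (0, 1) v).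

Definition form_eps (eps : R) (f : R * R -> R) :=
  form (fun x => (f x)^-1) (fun x => eps ^- 2 * f x).

Definition form_0 (eps : R) := form unit_weight (fun=> eps ^- 2).

(* Graph of the self-adjoint operator H in L^2(Pi, w ds dt) associated with the
   form h of domain W12, by the first representation theorem: u is in the domain
   of H and H u = eta. *)
Definition associated_operator w (h : (R * R -> R[i]) -> (R * R -> R[i]) -> R[i])
    u (eta : R * R -> R[i]) : Prop :=
  [/\ W12 u, L2 w eta & forall v, W12 v -> h u v = inner w eta v].

(* T = (H + 1)^-1 on L^2(Pi, w ds dt), for H given by its graph. *)
Definition is_resolvent w
    (H : (R * R -> R[i]) -> (R * R -> R[i]) -> Prop)
    (T : (R * R -> R[i]) -> (R * R -> R[i])) : Prop :=
  (forall g, L2 w g ->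
     exists2 eta, H (T g) eta & eq_ae (fun x => eta x + T g x) g) /\
  (forall u eta, H u eta -> eq_ae (T (fun x => eta x + u x)) u).

Definition Uop (f : R * R -> R) u : R * R -> R[i] :=
  fun x => (Num.sqrt (f x))%:C * u x.

Definition Uinv (f : R * R -> R) u : R * R -> R[i] :=
  fun x => ((Num.sqrt (f x))^-1)%:C * u x.

(* Operator norm on L^2(Pi) = L^2(Pi, ds dt). *)
Definition opnorm (T : (R * R -> R[i]) -> (R * R -> R[i])) : \bar R :=
  ereal_sup [set L2norm unit_weight (T g) | g in
    [set g | L2 unit_weight g /\ (L2norm unit_weight g <= 1)%E]].

End Strip.

(* Main.v *)
From mathcomp Require Import all_boot all_order all_algebra.
From mathcomp Require Import all_classical all_reals all_analysis.
From mathcomp Require Import measurable_realfun complex ring lra.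
Require Import Defs.

(** Comparing the two forms does not need derivatives of [f].  Put
    [u = (H_eps + 1)^-1 U^-1 g] and [u0 = (H_0 + 1)^-1 g].  Testing both weak
    equations with [u] and with [u0] shows that [u - u0] has energy
    [O(d^2) |g|^2] as soon as [|f - 1| <= d] on the strip, because the two forms
    differ by relatively small multiplicative weights.  After taking real parts
    this is one pointwise quadratic inequality, integrated over the strip; using
    only [u] and [u0] as test functions avoids the uniqueness of weak
    derivatives.

    The bound [|f - 1| = O(eps)] follows from the Jacobi equation once
    [K o Leps] and [kappa] are bounded uniformly in [eps].  For that, a geodesic
    of length [O(eps)] issued from [Gam] is shown to stay in a coordinate box by a
    continuity argument on the geodesic equation, and [[0, L]] is covered by
    finitely many such boxes.  The measurability of [f] comes from its continuity
    in [(s, t)], which holds because short geodesics depend Lipschitz-continuously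
    on their initial data. *)

Set Implicit Arguments.
Unset Strict Implicit.
Unset Printing Implicit Defensive.

Import Order.TTheory GRing.Theory Num.Theory.
Import numFieldNormedType.Exports.

Local Open Scope classical_set_scope.
Local Open Scope ring_scope.

(** * Short-time estimates for differential equations *)

Section RealODE.
Context {R : realType}.
Implicit Types (y dy : R -> R) (a b t x : R).

(** The exponential map is given as a relation, and [Leps], [N], [kappa] are constrained only by
    their defining equations, with no regularity assumed. Continuity has to be recovered: that of
    [N] and [kappa] from closed formulas in a chart, that of [Leps] from an estimate comparing two
    arbitrary geodesics. All these estimates run over bounded time with small coefficients, so
    suprema can be absorbed. The constant [M] of the bounds along the curve must be fixed before
    [eps]; it serves both as the bound and, through [eps * M <= 1], as the smallness threshold. It
    leads to [d = 4 * M * eps]. The error is quadratic in [d] before the square root is taken: the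
    first-order perturbations appear as cross terms against differences such as [u - u0], and
    completing squares turns them into [d ^+ 2] times the energy of [u], which the weak equation for
    [u] bounds by the square of the norm of [g]. *)

Lemma is_derive_within_nbhs (D : set R) y x l : nbhs x D ->
  is_derive_within D y x l -> is_derive x 1 y l.
Proof.
move=> Dx yl.
have cv : h^-1 *: (y (h *: 1 + x) - y x) @[h --> 0^'] --> l.
  apply/cvgrPdist_lt => e e0.
  move/cvgrPdist_lt : yl => /(_ _ e0).
  rewrite near_withinE => H.
  have /nbhs_ballP[d /= d0 Hd] :
      nbhs x (fun z => (D `\ x) z -> `|l - (y z - y x) / (z - x)| < e) by exact: H.
  have /nbhs_ballP[d' /= d'0 Hd'] := Dx.
  near=> h.
  have hn : h != 0 by near: h; exact: nbhs_dnbhs_neq.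
  have hd : `|h| < d by near: h; exact: dnbhs0_lt.
  have hd' : `|h| < d' by near: h; exact: dnbhs0_lt.
  have := Hd (h + x); rewrite addrK /ball /=.
  rewrite opprD addrCA subrr addr0 normrN => /(_ hd).
  rewrite [h *: 1]mulr1 mulrC; apply; split.
    by apply: Hd'; rewrite /ball /= opprD addrCA subrr addr0 normrN.
  by move=> /= /eqP; rewrite -subr_eq0 addrK; apply/negP.
by apply: DeriveDef; [apply/cvg_ex; exists l|exact/cvg_lim].
Unshelve. all: by end_near. Qed.

Lemma is_derive_continuous (V : normedModType R) (f : R -> V) x l :
  is_derive x 1 f l -> {for x, continuous f}.
Proof. by move=> [/derivable1_diffP/differentiable_continuous]. Qed.

Lemma mean_value_ineq y dy a b M :
  (forall x, x \in `[a, b] -> is_derive x 1 y (dy x)) ->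
  (forall x, x \in `[a, b] -> `|dy x| <= M) ->
  forall u v, u \in `[a, b] -> v \in `[a, b] -> `|y v - y u| <= M * `|v - u|.
Proof.
move=> dyP dyM u v.
wlog uv : u v / u <= v.
  move=> H uab vab; have [/H|/ltW /H] := leP u v; first exact.
  by rewrite distrC [`|_ - v|]distrC; exact.
move=> uab vab.
have sub x : x \in `[u, v] -> x \in `[a, b].
  rewrite !in_itv /= => /andP[ux xv].
  by rewrite (le_trans _ ux) ?(itvP uab)// (le_trans xv) ?(itvP vab).
have D x : x \in `]u, v[ -> is_derive x 1 y (dy x).
  by move=> xuv; apply/dyP/sub; apply: subset_itv_oo_cc.
have Cy : {within `[u, v], continuous y}.
  apply: continuous_in_subspaceT => x; rewrite inE => xuv.
  by apply: is_derive_continuous; exact/dyP/sub.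
have [c cuv E] := MVT_segment uv D Cy.
by rewrite E normrM ler_wpM2r// dyM// sub.
Qed.

(* On an interval of half-length at most 1 no Gronwall argument is needed:
   [a <= 1/2] lets the maximum of [|y|] be absorbed. *)
Lemma second_order_bound y y1 y2 p q a b :
  (forall t, t \in `]-1, 1[ -> is_derive t 1 y (y1 t)) ->
  (forall t, t \in `]-1, 1[ -> is_derive t 1 y1 (y2 t)) ->
  (forall t, t \in `]-1, 1[ -> `|y2 t| <= a * `|y t| + b) ->
  `|y 0| <= q -> `|y1 0| <= p -> 0 <= a -> a <= 1 / 2 -> 0 <= b ->
  forall t, t \in `]-1, 1[ -> `|y t| <= 2 * (q + p + b).
Proof.
move=> d1 d2 y2b y0 y10 a0 a2 b0 t; rewrite in_itv /= => /andP[t1 t2].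
have tlt : `|t| < 1 by rewrite ltr_norml t1.
have t0 : 0 <= `|t| by [].
(* The hypotheses hold only on the open interval, so the maximum of [|y|] is taken over the compact
   interval [[- T, T]], which contains both 0 and [t]. *)
set T := `|t| in tlt t0.
have sub x : x \in `[- T, T] -> x \in `]-1, 1[.
  by rewrite !in_itv /= => /andP[? ?]; apply/andP; split; lra.
have z : 0 \in `[- T, T] by rewrite in_itv /=; apply/andP; split; lra.
have TT : - T <= T by lra.
have Cy : {within `[- T, T], continuous (fun x => `|y x|)}.
  apply: continuous_in_subspaceT => x; rewrite inE => /sub/d1/is_derive_continuous h.
  exact: continuous_comp h (@norm_continuous _ _ _).
have [c cT cM] := EVT_max TT Cy.
set M := `|y c| in cM *.
have M0 : 0 <= M by exact: normr_ge0.
have aM x : x \in `[- T, T] -> `|y2 x| <= a * M + b.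
  move=> xT; apply: le_trans (y2b _ (sub _ xT)) _.
  by rewrite lerD2r ler_wpM2l// cM.
have absT x : x \in `[- T, T] -> `|x - 0| <= 1.
  by rewrite in_itv /= subr0 ler_norml => /andP[? ?]; apply/andP; split; lra.
have y1b x : x \in `[- T, T] -> `|y1 x| <= p + (a * M + b).
  move=> xT; have := mean_value_ineq (fun x xT => d2 x (sub x xT)) aM z xT.
  move=> h.
  have h2 : `|y1 x - y1 0| <= a * M + b.
    apply: le_trans h _; rewrite ler_piMr ?absT//.
    by rewrite (le_trans _ (aM _ z)).
  by have := ler_normD (y1 0) (y1 x - y1 0); rewrite addrC subrK; lra.
have yb : M <= q + (p + (a * M + b)).
  have := mean_value_ineq (fun x xT => d1 x (sub x xT)) y1b z cT.
  move=> h.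
  have h2 : `|y c - y 0| <= p + (a * M + b).
    apply: le_trans h _; rewrite ler_piMr ?absT//.
    by rewrite (le_trans _ (y1b _ z)).
  by have := ler_normD (y 0) (y c - y 0); rewrite addrC subrK -/M; lra.
have aM2 : a * M <= 1 / 2 * M by rewrite ler_wpM2r.
have : `|y t| <= M by apply: cM; rewrite in_itv /= -ler_norml.
lra.
Qed.

End RealODE.

(** * Induction over the unit interval *)

Section RealInduction.
Context {R : realType}.

(** Connectedness of [[0, 1]] in the form a bootstrap needs: the first premise may use [P] at all
    earlier times, so that derivative bounds can be integrated up to [u]. At [u = 0] nothing is
    earlier, and this premise becomes the initial condition. *)
Lemma real_induction (P : R -> Prop) :
  (forall u : R, 0 <= u <= 1 -> (forall t, 0 <= t < u -> P t) -> P u) ->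
  (forall u : R, 0 <= u < 1 -> P u -> \forall t \near u, P t) ->
  forall t, 0 <= t <= 1 -> P t.
Proof.
move=> closedP openP.
pose S := [set u : R | 0 <= u <= 1 /\ forall t, 0 <= t < u -> P t].
have S0 : S 0.
  by split=> [|t]; [lra|move=> /andP[t0 t0']; have := le_lt_trans t0 t0'; rewrite ltxx].
have hS : has_sup S by split; [exists 0|exists 1 => u [/andP[]]].
have u1 : sup S <= 1 by apply: ge_sup; [exists 0|move=> u [/andP[]]].
have u0 : 0 <= sup S by apply: ub_le_sup S0; case: hS.
have ltu t : 0 <= t < sup S -> P t.
  move=> /andP[t0 tu]; have [u [_ Su] tu'] := @sup_gt _ S t (ex_intro _ _ S0) tu.
  by apply: Su; rewrite t0.
have Pu : P (sup S) by apply: closedP; rewrite ?u0 ?u1.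
have [u1'|] := ltP (sup S) 1; last first.
  move=> u1' t /andP[t0 t1]; have [tu|tu] := ltP t (sup S); first by apply: ltu; rewrite t0.
  by rewrite (_ : t = sup S)//; apply/eqP; rewrite eq_le tu (le_trans t1).
have /nbhs_ballP[d /= d0 dP] : \forall t \near sup S, P t by apply: openP => //; rewrite u0.
(* [w] overshoots the supremum while staying where [P] is known; membership of [w] in [S] is then
   absurd. *)
pose w := Num.min 1 (sup S + d / 2).
have : S w.
  split; first by rewrite /w ge_min lexx le_min ler01/=; lra.
  move=> t /andP[t0]; rewrite lt_min => /andP[_ tw].
  have [tu|tu] := ltP t (sup S); first by apply: ltu; rewrite t0.
  by apply: dP; rewrite /ball /= distrC ger0_norm; lra.
move=> Sw; have : w <= sup S by apply: ub_le_sup Sw; case: hS.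
by rewrite /w ge_min => /orP[]; lra.
Qed.

Lemma near_left_ex (Q : R -> Prop) (u : R) : 0 < u ->
  (\forall t \near u, Q t) -> exists2 t, 0 <= t < u & Q t.
Proof.
move=> u0 /nbhs_ballP[d /= d0 dQ].
exists (Num.max 0 (u - d / 2)).
  by rewrite le_max lexx gt_max u0 /=; lra.
apply: dQ; rewrite /ball /=.
by case: (leP 0 (u - d / 2)) => h; rewrite ger0_norm; lra.
Qed.

End RealInduction.

(** * Smooth functions on open sets *)

Section SmoothAlgebra.
Context {R : realType} {V : normedModType R} (U : set V).
Hypothesis openU : open U.
Implicit Types (f g : V -> R).

Lemma near_open (P : V -> Prop) x : U x -> (forall y, U y -> P y) ->
  \forall y \near x, P y.
Proof. by move=> Ux UP; exact: (filterS UP (open_nbhs_nbhs (conj openU Ux))). Qed.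

Lemma Ck_on_continuous k (W : normedModType R) (f : V -> W) x :
  Ck_on k U f -> U x -> {for x, continuous f}.
Proof. by case: k => [|k] [h _]; exact: h. Qed.

Lemma Ck_on_derivable k (W : normedModType R) (f : V -> W) v x :
  Ck_on k.+1 U f -> U x -> derivable f x v.
Proof. by move=> [_ /(_ v)[h _]]; exact: h. Qed.

Lemma Ck_on_derive k (W : normedModType R) (f : V -> W) v :
  Ck_on k.+1 U f -> Ck_on k U ('D_v f).
Proof. by move=> [_ /(_ v)[]]. Qed.

Lemma continuous_at_ext (W : normedModType R) (f g : V -> W) x :
  (forall y, U y -> f y = g y) -> U x ->
  {for x, continuous f} -> {for x, continuous g}.
Proof.
move=> fg Ux cf; suff: g y @[y --> x] --> g x by [].
rewrite -fg//; apply: cvg_trans cf.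
by apply: near_eq_cvg; exact: near_open.
Qed.

(** As [U] is open, derivatives at its points depend only on values in [U]. The product and quotient
    rules, valid only on [U], can therefore replace ['D_v] in the inductions on [k]. *)
Lemma Ck_on_ext k (W : normedModType R) (f g : V -> W) :
  (forall x, U x -> f x = g x) -> Ck_on k U f -> Ck_on k U g.
Proof.
elim: k f g => [|k IH] f g fg /=.
  by move=> [cf _]; split=> // x Ux; exact: continuous_at_ext (cf x Ux).
move=> [cf df]; split.
  by move=> x Ux; exact: continuous_at_ext (cf x Ux).
move=> v; have [df1 df2] := df v; split.
  by move=> x Ux; apply: near_eq_derivable (df1 x Ux); exact: near_open.
apply: IH df2 => x Ux.
by apply: near_eq_derive; exact: near_open.
Qed.

Lemma Ck_on_le k (W : normedModType R) (f : V -> W) :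
  Ck_on k.+1 U f -> Ck_on k U f.
Proof.
elim: k f => [|k IH] f; first by move=> [].
move=> [cf df]; split=> // v.
by have [d1 d2] := df v; split=> //; exact: IH.
Qed.

Lemma Ck_on_cst k (W : normedModType R) (c : W) : Ck_on k U (fun=> c).
Proof.
elim: k c => [|k IH] c; split=> //.
- by move=> x _; exact: cst_continuous.
- by move=> x _; exact: cst_continuous.
move=> v; split; first by move=> x _; exact: derivable_cst.
by apply: (Ck_on_ext _ (IH 0)) => x _; rewrite derive_cst.
Qed.

Lemma Ck_onD k f g : Ck_on k U f -> Ck_on k U g -> Ck_on k U (fun x => f x + g x).
Proof.
elim: k f g => [|k IH] f g cf cg; split=> //.
- by move=> x Ux; apply: cvgD; apply: (Ck_on_continuous _ Ux); eassumption.
- by move=> x Ux; apply: cvgD; apply: (Ck_on_continuous _ Ux); eassumption.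
move=> v; split.
  by move=> x Ux; apply: derivableD; apply: Ck_on_derivable Ux; eassumption.
apply: (Ck_on_ext _ (IH _ _ (Ck_on_derive v cf) (Ck_on_derive v cg))) => x Ux.
by rewrite [RHS]deriveD//; apply: Ck_on_derivable Ux; eassumption.
Qed.

Lemma Ck_onM k f g : Ck_on k U f -> Ck_on k U g -> Ck_on k U (fun x => f x * g x).
Proof.
elim: k f g => [|k IH] f g cf cg; split=> //.
- by move=> x Ux; apply: cvgM; apply: (Ck_on_continuous _ Ux); eassumption.
- by move=> x Ux; apply: cvgM; apply: (Ck_on_continuous _ Ux); eassumption.
move=> v; split.
  by move=> x Ux; apply: derivableM; apply: Ck_on_derivable Ux; eassumption.
apply: (Ck_on_ext _ (Ck_onD (IH _ _ (Ck_on_le cf) (Ck_on_derive v cg))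
  (IH _ _ (Ck_on_le cg) (Ck_on_derive v cf)))) => x Ux.
by rewrite [RHS]deriveM//; apply: Ck_on_derivable Ux; eassumption.
Qed.

Lemma Ck_onV k f : (forall x, U x -> f x != 0) -> Ck_on k U f ->
  Ck_on k U (fun x => (f x)^-1).
Proof.
move=> f0; elim: k f f0 => [|k IH] f f0 cf; split=> //.
- by move=> x Ux; apply: cvgV; [exact: f0|exact: (Ck_on_continuous cf Ux)].
- by move=> x Ux; apply: cvgV; [exact: f0|exact: (Ck_on_continuous cf Ux)].
move=> v; split.
  by move=> x Ux; apply: derivableV; [exact: f0|exact: Ck_on_derivable cf Ux].
have h := IH _ f0 (Ck_on_le cf).
apply: (Ck_on_ext _ (Ck_onM (Ck_on_cst k (-1 : R)) (Ck_onM (Ck_onM h h)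
   (Ck_on_derive v cf)))) => x Ux.
rewrite [RHS]deriveV//; [|exact: f0|exact: Ck_on_derivable cf Ux].
by rewrite mulN1r -[_ *: _]/(_ * _) -exprVn expr2 mulNr.
Qed.

Lemma Ck_on_entry k m n (F : V -> 'M[R]_(m, n)) i j :
  Ck_on k U F -> Ck_on k U (fun x => F x i j).
Proof.
have cc (G : V -> 'M[R]_(m, n)) x : {for x, continuous G} ->
    {for x, continuous (fun x => G x i j)}.
  by move=> h; apply: continuous_comp h (@coord_continuous _ _ _ _ _ _).
elim: k F => [|k IH] F cF; split=> //.
- by move=> x Ux; apply: cc; apply: (Ck_on_continuous _ Ux); eassumption.
- by move=> x Ux; apply: cc; apply: (Ck_on_continuous _ Ux); eassumption.
move=> v; split.
  by move=> x Ux; apply/(derivable_mxP F x v).1; apply: Ck_on_derivable Ux; eassumption.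
apply: (Ck_on_ext _ (IH _ (Ck_on_derive v cF))) => x Ux.
by rewrite derive_mx ?mxE//; apply: Ck_on_derivable Ux; eassumption.
Qed.

Lemma smooth_on_ext (W : normedModType R) (f g : V -> W) :
  (forall x, U x -> f x = g x) -> smooth_on U f -> smooth_on U g.
Proof. by move=> fg h k; apply: Ck_on_ext (h k). Qed.

Lemma smooth_on_cst (c : R) : smooth_on U (fun=> c).
Proof. by move=> k; exact: Ck_on_cst. Qed.

Lemma smooth_onD f g : smooth_on U f -> smooth_on U g ->
  smooth_on U (fun x => f x + g x).
Proof. by move=> hf hg k; exact: Ck_onD. Qed.

Lemma smooth_onM f g : smooth_on U f -> smooth_on U g ->
  smooth_on U (fun x => f x * g x).
Proof. by move=> hf hg k; exact: Ck_onM. Qed.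

Lemma smooth_onN f : smooth_on U f -> smooth_on U (fun x => - f x).
Proof.
move=> hf; apply: (smooth_on_ext _ (smooth_onM (smooth_on_cst (-1)) hf)) => x _.
by rewrite mulN1r.
Qed.

Lemma smooth_onB f g : smooth_on U f -> smooth_on U g ->
  smooth_on U (fun x => f x - g x).
Proof. by move=> hf hg; exact/smooth_onD/smooth_onN. Qed.

Lemma smooth_onV f : (forall x, U x -> f x != 0) -> smooth_on U f ->
  smooth_on U (fun x => (f x)^-1).
Proof. by move=> f0 hf k; exact: Ck_onV. Qed.

Lemma smooth_on_derive (W : normedModType R) (f : V -> W) v :
  smooth_on U f -> smooth_on U ('D_v f).
Proof. by move=> hf k; exact: Ck_on_derive. Qed.

Lemma smooth_on_entry m n (F : V -> 'M[R]_(m, n)) i j :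
  smooth_on U F -> smooth_on U (fun x => F x i j).
Proof. by move=> hf k; exact: Ck_on_entry. Qed.

Lemma smooth_on_sum (I : eqType) (r : seq I) (F : I -> V -> R) :
  (forall i, smooth_on U (F i)) -> smooth_on U (fun x => \sum_(i <- r) F i x).
Proof.
move=> hF; elim: r => [|i r IH].
  by apply: (smooth_on_ext _ (smooth_on_cst 0)) => x _; rewrite big_nil.
by apply: (smooth_on_ext _ (smooth_onD (hF i) IH)) => x _; rewrite big_cons.
Qed.

End SmoothAlgebra.

(** * Coordinate boxes and Lipschitz bounds *)

Section Boxes.
Context {R : realType}.

Lemma normrV_leP n (v : 'rV[R]_n) (b : R) : 0 <= b ->
  reflect (forall j, `|v 0 j| <= b) (`|v| <= b).
Proof.
move=> b0; rewrite [`|v|]mx_normrE.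
apply: (iffP idP) => [h j|h].
  by apply: le_trans h; exact: (le_bigmax _ (fun ij : 'I_1 * 'I_n => `|v ij.1 ij.2|) (0, j)).
by apply: bigmax_le => // -[i j] _ /=; rewrite (ord1 i).
Qed.

Lemma normrV_entry n (v : 'rV[R]_n) j : `|v 0 j| <= `|v|.
Proof. by apply/normrV_leP. Qed.

Lemma normrV_entryB n (u v : 'rV[R]_n) j : `|u 0 j - v 0 j| <= `|u - v|.
Proof. by have := normrV_entry (u - v) j; rewrite !mxE. Qed.

Lemma normrV_distP n (u v : 'rV[R]_n) (b : R) : 0 <= b ->
  (forall j, `|u 0 j - v 0 j| <= b) -> `|u - v| <= b.
Proof. by move=> b0 h; apply/(normrV_leP _ b0) => j; rewrite !mxE. Qed.

Lemma ord2P (P : 'I_2 -> Prop) : P 0 -> P 1 -> forall j, P j.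
Proof.
move=> P0 P1 [[|[|//]] lt].
  by rewrite (_ : Ordinal lt = 0)//; exact/val_inj.
by rewrite (_ : Ordinal lt = 1)//; exact/val_inj.
Qed.

Lemma rV2_eq (x y : 'rV[R]_2) : x 0 0 = y 0 0 -> x 0 1 = y 0 1 -> x = y.
Proof. by move=> e0 e1; apply/rowP; exact: ord2P. Qed.

(** The norm of a row vector is the maximum of its entries, so this is a closed cube: estimates
    split into coordinates, and paths parallel to the axes can stay inside. *)
Definition box n (x0 : 'rV[R]_n) (r : R) : set 'rV[R]_n :=
  [set x | `|x - x0| <= r].

Lemma box_compact n (x0 : 'rV[R]_n) (r : R) : 0 <= r -> compact (box x0 r).
Proof.
move=> r0.
rewrite (_ : box x0 r = [set v | forall j, `[x0 0 j - r, x0 0 j + r]%classic (v 0 j)]).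
  by apply: (@rV_compact _ _ (fun j => `[x0 0 j - r, x0 0 j + r]%classic)) => j;
    exact: segment_compact.
apply/seteqP; split=> x /=.
  by move=> /(normrV_leP _ r0) h j; have := h j; rewrite !mxE in_itv /= ler_distl.
by move=> h; apply/(normrV_leP _ r0) => j; have := h j; rewrite !mxE in_itv /= ler_distl.
Qed.

Lemma compact_bounded (T : topologicalType) (B : set T) (f : T -> R) :
  compact B -> (forall x, B x -> {for x, continuous f}) ->
  exists2 M, 0 <= M & forall x, B x -> `|f x| <= M.
Proof.
move=> cB cf; have [->|/set0P B0] := eqVneq B set0; first by exists 0.
have cfB : {within B, continuous (fun x => `|f x|)}.
  apply: continuous_in_subspaceT => x; rewrite inE => Bx.
  exact: continuous_comp (cf x Bx) (@norm_continuous _ _ _).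
have [c _ cM] := compact_EVT_max B0 cB cfB.
by exists `|f c| => // x Bx; apply: cM; rewrite inE.
Qed.

(** The two difference quotients coincide, so derivability in the single direction [e] suffices and
    no total differentiability enters. *)
Lemma is_derive_line (V W : normedModType R) (f : V -> W) (p e : V) (t : R) :
  derivable f (p + t *: e) e ->
  is_derive t 1 (fun t : R => f (p + t *: e)) ('D_e f (p + t *: e)).
Proof.
move=> df.
have E : (fun h : R => h^-1 *: (f (p + (h *: (1 : R) + t) *: e) - f (p + t *: e))) =
  (fun h : R => h^-1 *: (f (h *: e + (p + t *: e)) - f (p + t *: e))).
  apply/funext => h; congr (_ *: (f _ - _)).
  by rewrite [h *: 1]mulr1 scalerDl addrCA.
apply: DeriveDef; first by rewrite /derivable/= /shift /= E.
by rewrite /derive /= /shift /= E.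
Qed.

(* The two points are joined by a path parallel to the axes, so that only
   partial derivatives are needed. *)
Lemma Ck_on_lipschitz (U : set 'rV[R]_2) (f : 'rV[R]_2 -> R) x0 (r : R) :
  Ck_on 1 U f -> 0 <= r -> box x0 r `<=` U ->
  exists2 M, 0 <= M & forall x, box x0 r x ->
    `|f x| <= M /\ forall y, box x0 r y -> `|f x - f y| <= M * `|x - y|.
Proof.
move=> cf r0 BU.
have cB : compact (box x0 r) by exact: box_compact.
have [M0 M00 fM0] := compact_bounded cB
  (fun x Bx => Ck_on_continuous cf (BU x Bx)).
have dM a := compact_bounded cB (fun x Bx =>
  Ck_on_continuous (Ck_on_derive (delta_mx 0 a) cf) (BU x Bx)).
have [M1 M10 fM1] := dM 0.
have [M2 M20 fM2] := dM 1.
exists (M0 + (M1 + M2)); first by rewrite !addr_ge0.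
have step (a : 'I_2) (M : R) : 0 <= M ->
  (forall x, box x0 r x -> `|'D_(delta_mx 0 a) f x| <= M) ->
  forall (p : 'rV[R]_2) s, box x0 r p -> box x0 r (p + s *: delta_mx 0 a) ->
  `|f (p + s *: delta_mx 0 a) - f p| <= M * `|s|.
  move=> M_ge0 fM p s Bp Bq.
  set e := delta_mx 0 a.
  have Bt t : (0 <= t <= s) || (s <= t <= 0) -> box x0 r (p + t *: e).
    move=> ts; apply/(normrV_leP _ r0) => j.
    move/(normrV_leP _ r0) : Bp => /(_ j).
    move/(normrV_leP _ r0) : Bq => /(_ j).
    rewrite !mxE /= !ler_distl; case: (j == a) => /=; rewrite ?mulr1 ?mulr0; last first.
      by rewrite !addr0.
    by case/orP : ts => /andP[? ?] /andP[? ?] /andP[? ?]; apply/andP; split; lra.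
  have h t : t \in `[Num.min 0 s, Num.max 0 s] -> (0 <= t <= s) || (s <= t <= 0).
    by rewrite in_itv /=; case: (leP 0 s) => _ ->; rewrite ?orbT.
  have := @mean_value_ineq R (fun t => f (p + t *: e)) (fun t => 'D_e f (p + t *: e))
   (Num.min 0 s) (Num.max 0 s) M.
  have D t : t \in `[Num.min 0 s, Num.max 0 s] ->
     is_derive t 1 (fun t => f (p + t *: e)) ('D_e f (p + t *: e)).
    by move=> /h /Bt Bpt; apply: is_derive_line; exact: Ck_on_derivable cf (BU _ Bpt).
  move=> /(_ D (fun t ht => fM _ (Bt _ (h _ ht))) 0 s).
  rewrite !in_itv /= !ge_min !le_max !lexx /= !orbT => /(_ isT isT).
  by rewrite scale0r addr0 subr0.
move=> x Bx; split.
  by rewrite (le_trans (fM0 _ Bx))// lerDl addr_ge0.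
move=> y By.
(* The corner of the path: first coordinate of [x], second coordinate of [y]. *)
pose z := y + (x 0 0 - y 0 0) *: delta_mx 0 0.
have zE : x = z + (x 0 1 - y 0 1) *: delta_mx 0 1.
  by apply: rV2_eq; rewrite !mxE /=; ring.
have Bz : box x0 r z.
  apply/(normrV_leP _ r0); apply: ord2P.
    move/(normrV_leP _ r0) : Bx => /(_ 0); rewrite !mxE /=.
    by rewrite (_ : _ + _ * 1 = x 0 0); last ring.
  move/(normrV_leP _ r0) : By => /(_ 1); rewrite !mxE /=.
  by rewrite mulr0 addr0.
have s1 := step 0 M1 M10 fM1 y (x 0 0 - y 0 0) By Bz.
have s2 := step 1 M2 M20 fM2 z (x 0 1 - y 0 1) Bz.
rewrite -zE in s2; have {}s2 := s2 Bx.
rewrite -/z in s1.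
have n0 := normrV_entry (x - y) 0; have n1 := normrV_entry (x - y) 1.
rewrite !mxE in n0 n1.
have := ler_normD (f x - f z) (f z - f y); rewrite subrKA => h.
rewrite (le_trans h)// (le_trans (lerD s2 s1))//.
rewrite !mulrDl addrC -[leLHS]add0r lerD ?mulr_ge0// lerD// ler_wpM2l//.
Qed.

End Boxes.

(** * Smoothness of the metric coefficients *)

Section MetricSmooth.
Context {R : realType} {A : oriented_surface R}.
Implicit Types (i : chart A) (x : 'rV[R]_2).

Lemma sum_ord2 (V : nmodType) (F : 'I_2 -> V) : \sum_(i < 2) F i = F 0 + F 1.
Proof.
by rewrite big_ord_recl big_ord1; congr (_ + F _); apply/val_inj.
Qed.

Lemma det_mx22 (M : 'M[R]_2) : \det M = M 0 0 * M 1 1 - M 0 1 * M 1 0.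
Proof.
rewrite (expand_det_row _ 0) sum_ord2 /cofactor !det_mx11 !mxE /=.
have -> : lift (0 : 'I_2) (0 : 'I_1) = 1 by exact/val_inj.
have -> : lift (1 : 'I_2) (0 : 'I_1) = 0 by exact/val_inj.
by rewrite /= !addn0 !add0n expr0 expr1; ring.
Qed.

Lemma metric_det_neq0 i x : cran i x -> \det (metric i x) != 0.
Proof.
move=> xi; apply/negP => /det0P[v v0 v1].
by have := metric_posdef xi v0; rewrite v1 mul0mx mxE ltxx.
Qed.

Lemma metric_entry_smooth i (a b : 'I_2) :
  smooth_on (cran i) (fun x => metric i x a b).
Proof. by apply: smooth_on_entry; [exact: cran_open|exact: metric_smooth]. Qed.

Lemma metric_det_smooth i : smooth_on (cran i) (fun x => \det (metric i x)).
Proof.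
have h a b := metric_entry_smooth i a b.
have o := @cran_open _ _ i.
apply: (smooth_on_ext o _ (smooth_onB o (smooth_onM o (h 0 0) (h 1 1))
  (smooth_onM o (h 0 1) (h 1 0)))) => x _.
by rewrite det_mx22.
Qed.

Lemma christoffel_smooth i (d a b : 'I_2) :
  smooth_on (cran i) (fun x => christoffel i x d a b).
Proof.
have h a' b' := metric_entry_smooth i a' b'.
have o := @cran_open _ _ i.
apply: smooth_onM => //; first exact: smooth_on_cst.
apply: smooth_on_sum => // e.
apply: smooth_onM => //; last first.
  by apply: smooth_onB => //; [apply: smooth_onD => //|]; exact: smooth_on_derive.
(* Cramer's rule: an entry of the inverse is the inverse determinant times a cofactor, and in
   dimension two a cofactor is a single entry up to sign. *)
have hV := smooth_onV o (@metric_det_neq0 i) (@metric_det_smooth i).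
apply: (smooth_on_ext o _ (smooth_onM o hV (smooth_onM o
  (smooth_on_cst o ((-1) ^+ (e + d))) (h (lift e 0) (lift d 0))))) => x xi.
rewrite /invmx unitmxE unitfE metric_det_neq0// !mxE /cofactor.
by rewrite det_mx11 !mxE.
Qed.

Lemma gauss_chart_smooth i : smooth_on (cran i) (gauss_chart i).
Proof.
have h d a b := christoffel_smooth i d a b.
have o := @cran_open _ _ i.
apply: smooth_onM => //; last exact: smooth_onV (@metric_det_neq0 i) (@metric_det_smooth i).
apply: smooth_on_sum => // d; apply: smooth_onM => //; last exact: metric_entry_smooth.
apply: smooth_onD => //.
  by apply: smooth_onB => //; apply: smooth_on_derive.
by apply: smooth_on_sum => // e; apply: smooth_onB => //; apply: smooth_onM.
Qed.

End MetricSmooth.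

(** * Short geodesics in a chart *)

Lemma is_derive_entry (R : realType) n (F : R -> 'rV[R]_n) (t : R) d :
  derivable F t 1 -> is_derive t 1 (fun s => F s 0 d) (derive1 F t 0 d).
Proof.
move=> dF; apply: DeriveDef; first exact/(derivable_mxP F t 1).1.
by rewrite derive1E derive_mx// mxE.
Qed.

Section CurveInChart.
Context {R : realType} {A : oriented_surface R}.
Variables (c : R -> A) (J : set R) (i : chart A).
Hypothesis openJ : open J.
Hypothesis smooth_c : smooth_curve J c.

Definition curve_dom := J `&` c @^-1` cdom i.
Local Notation U := curve_dom.

Lemma curve_dom_open : open U.
Proof.
rewrite openE => t [Jt ct]; rewrite /interior.
apply: filterI; first exact: open_nbhs_nbhs.
by apply: (smooth_c.1 _ Jt); apply: open_nbhs_nbhs; split=> //; exact: cdom_open.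
Qed.

Lemma curve_smooth : smooth_on U (cmap i \o c).
Proof. exact: smooth_c.2. Qed.

Lemma velocityE : velocity c i = 'D_1 (cmap i \o c).
Proof. by apply/funext => t; rewrite /velocity derive1E. Qed.

Lemma velocity_smooth : smooth_on U (velocity c i).
Proof. by rewrite velocityE; apply: smooth_on_derive; exact: curve_smooth. Qed.

Lemma acceleration_smooth : smooth_on U (derive1 (velocity c i)).
Proof.
rewrite (_ : derive1 _ = 'D_1 (velocity c i)); last first.
  by apply/funext => t; rewrite derive1E.
by apply: smooth_on_derive; exact: velocity_smooth.
Qed.

Lemma curve_continuous t : U t -> {for t, continuous (cmap i \o c)}.
Proof. by move=> Ut; exact: Ck_on_continuous (curve_smooth 0) Ut. Qed.

Lemma velocity_continuous t : U t -> {for t, continuous (velocity c i)}.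
Proof. by move=> Ut; exact: Ck_on_continuous (velocity_smooth 0) Ut. Qed.

Lemma acceleration_continuous t : U t ->
  {for t, continuous (derive1 (velocity c i))}.
Proof. by move=> Ut; exact: Ck_on_continuous (acceleration_smooth 0) Ut. Qed.

Lemma is_derive_curve t d : U t ->
  is_derive t 1 (fun s => cmap i (c s) 0 d) (velocity c i t 0 d).
Proof.
by move=> Ut; apply: is_derive_entry; exact: Ck_on_derivable (curve_smooth 1) Ut.
Qed.

Lemma is_derive_velocity t d : U t ->
  is_derive t 1 (fun s => velocity c i s 0 d) (derive1 (velocity c i) t 0 d).
Proof.
by move=> Ut; apply: is_derive_entry; exact: Ck_on_derivable (velocity_smooth 1) Ut.
Qed.

End CurveInChart.

Lemma entry_continuous_at (R : realType) (T : topologicalType) m n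
    (F : T -> 'M[R]_(m, n)) a b x :
  {for x, continuous F} -> {for x, continuous (fun y => F y a b)}.
Proof. by move=> h; apply: continuous_comp h (@coord_continuous _ _ _ _ _ _). Qed.

Section Triangle.
Context {R : realType} {V : normedModType R}.
Implicit Types (x y z : V) (e : R).

Lemma dist_triangle_lt x y z e :
  `|x - y| < e - `|y - z| -> `|x - z| < e.
Proof. by rewrite ltrBrDr; apply: le_lt_trans; exact: ler_distD. Qed.

Lemma dist_triangle_le x y z e e1 e2 :
  `|x - y| <= e1 -> `|y - z| <= e2 -> e1 + e2 <= e -> `|x - z| <= e.
Proof.
by move=> h1 h2; apply: le_trans; apply: le_trans (ler_distD y _ _) (lerD h1 h2).
Qed.

Lemma norm_triangle_lt x y e : `|x - y| < e - `|y| -> `|x| < e.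
Proof. by move=> h; rewrite -[x]subr0 (@dist_triangle_lt _ y)// subr0. Qed.

Lemma norm_triangle_le x y e e1 e2 :
  `|x - y| <= e1 -> `|y| <= e2 -> e1 + e2 <= e -> `|x| <= e.
Proof.
by move=> h1 h2 h3; rewrite -[x]subr0 (dist_triangle_le h1 _ h3)// subr0.
Qed.

End Triangle.

(** The model is the right-hand side of the geodesic equation, quadratic in the velocity. Each of
    the four products is telescoped by changing one factor at a time, which costs
    [4 * C * rho ^+ 2 * dx + 4 * C * rho * dv]. *)
Lemma quadratic_lipschitz (R : realType) (F G : 'I_2 -> 'I_2 -> R)
    (V W : 'I_2 -> R) (C rho dx dv : R) : 0 <= C -> 0 <= rho ->
  (forall a b, `|F a b - G a b| <= C * dx) -> (forall a b, `|G a b| <= C) ->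
  (forall a, `|V a| <= 2 * rho) -> (forall a, `|W a| <= 2 * rho) ->
  (forall a, `|V a - W a| <= dv) ->
  `|- (\sum_(a < 2) \sum_(b < 2) F a b * V a * V b)
    - - (\sum_(a < 2) \sum_(b < 2) G a b * W a * W b)| <=
    16 * C * rho ^+ 2 * dx + 16 * C * rho * dv.
Proof.
move=> C0 rho0 FG Gb Vb Wb VW.
have addB (x y a b : R) : `|x| <= a -> `|y| <= b -> `|x + y| <= a + b.
  by move=> xa yb; apply: le_trans (ler_normD _ _) (lerD xa yb).
have mulB (x y z a b c : R) : `|x| <= a -> `|y| <= b -> `|z| <= c ->
    `|x * y * z| <= a * b * c.
  by move=> xa yb zc; rewrite !normrM !ler_pM// mulr_ge0.
have term a b : `|F a b * V a * V b - G a b * W a * W b| <=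
    C * dx * (2 * rho) * (2 * rho) + (C * dv * (2 * rho) + C * (2 * rho) * dv).
  have -> : F a b * V a * V b - G a b * W a * W b =
    (F a b - G a b) * V a * V b
     + (G a b * (V a - W a) * V b + G a b * W a * (V b - W b)) by ring.
  by apply: (@addB); [|apply: (@addB)]; apply: (@mulB).
rewrite !sum_ord2.
have t00 := term 0 0; have t01' := term 0 1; have t10 := term 1 0; have t11 := term 1 1.
have -> : - (F 0 0 * V 0 * V 0 + F 0 1 * V 0 * V 1 + (F 1 0 * V 1 * V 0 + F 1 1 * V 1 * V 1))
  - - (G 0 0 * W 0 * W 0 + G 0 1 * W 0 * W 1 + (G 1 0 * W 1 * W 0 + G 1 1 * W 1 * W 1)) =
  - ((F 0 0 * V 0 * V 0 - G 0 0 * W 0 * W 0) + (F 0 1 * V 0 * V 1 - G 0 1 * W 0 * W 1)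
   + ((F 1 0 * V 1 * V 0 - G 1 0 * W 1 * W 0) + (F 1 1 * V 1 * V 1 - G 1 1 * W 1 * W 1))) by ring.
rewrite normrN.
have -> : 16 * C * rho ^+ 2 * dx + 16 * C * rho * dv =
  (C * dx * (2 * rho) * (2 * rho) + (C * dv * (2 * rho) + C * (2 * rho) * dv)
   + (C * dx * (2 * rho) * (2 * rho) + (C * dv * (2 * rho) + C * (2 * rho) * dv)))
  + (C * dx * (2 * rho) * (2 * rho) + (C * dv * (2 * rho) + C * (2 * rho) * dv)
   + (C * dx * (2 * rho) * (2 * rho) + (C * dv * (2 * rho) + C * (2 * rho) * dv))) by ring.
by apply: (@addB); apply: (@addB).
Qed.

Section Geodesics.
Context {R : realType} {A : oriented_surface R}.
Variables (i : chart A) (x0 : 'rV[R]_2) (r C rho : R).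
Hypothesis r_gt0 : 0 < r.
Hypothesis box_cran : box x0 (2 * r) `<=` cran i.
Hypothesis C_ge0 : 0 <= C.
Hypothesis christoffel_bound : forall d a b x, box x0 (2 * r) x ->
  `|christoffel i x d a b| <= C.
Hypothesis christoffel_lipschitz : forall d a b x y,
  box x0 (2 * r) x -> box x0 (2 * r) y ->
  `|christoffel i x d a b - christoffel i y d a b| <= C * `|x - y|.
Hypothesis rho_gt0 : 0 < rho.
Hypothesis rho_r : 4 * rho <= r.
Hypothesis rho_2 : 2 * rho <= 1.
Hypothesis rho_C : 64 * C * rho <= 1.

Definition in_box_at (c : R -> A) (t : R) :=
  [/\ cdom i (c t), box x0 (2 * r) (cmap i (c t)) & `|velocity c i t| <= 2 * rho].

Lemma geodesic_acceleration c t d : is_geodesic c -> t \in `[0, 1] ->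
  cdom i (c t) ->
  derive1 (velocity c i) t 0 d = - \sum_(a < 2) \sum_(b < 2)
    christoffel i (cmap i (c t)) d a b * velocity c i t 0 a * velocity c i t 0 b.
Proof.
move=> [_ gc] t01 ct; have /rowP/(_ d) := gc t i t01 ct.
by rewrite !mxE => /eqP; rewrite addr_eq0 => /eqP.
Qed.

Lemma geodesic_acceleration_bound c t d : is_geodesic c -> t \in `[0, 1] ->
  in_box_at c t -> `|derive1 (velocity c i) t 0 d| <= 16 * C * rho ^+ 2.
Proof.
move=> gc t01 [ct bt vt]; rewrite geodesic_acceleration// normrN.
have term a b : `|christoffel i (cmap i (c t)) d a b * velocity c i t 0 a
    * velocity c i t 0 b| <= C * (2 * rho) * (2 * rho).
  have va e := le_trans (normrV_entry (velocity c i t) e) vt.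
  rewrite 2!normrM; apply: ler_pM; rewrite ?mulr_ge0 ?normr_ge0 ?va//.
  by apply: ler_pM => //; exact: christoffel_bound.
rewrite !sum_ord2.
have t00 := term 0 0; have t01' := term 0 1; have t10 := term 1 0; have t11 := term 1 1.
set e00 := (X in `|X + _ + _|); set e01 := (X in `|_ + X + _|).
set e10 := (X in `|_ + (X + _)|); set e11 := (X in `|_ + (_ + X)|).
have h1 := ler_normD (e00 + e01) (e10 + e11).
have h2 := ler_normD e00 e01; have h3 := ler_normD e10 e11.
have -> : 16 * C * rho ^+ 2 = 4 * (C * (2 * rho) * (2 * rho)) by ring.
by lra.
Qed.

Lemma chart_point p : cran i p -> cdom i (cinv i p) /\ cmap i (cinv i p) = p.
Proof. by move=> [q qi <-]; rewrite cmapK. Qed.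

(** A compact set in a Hausdorff space is closed. This keeps the limit point of a curve inside the
    chart domain, where its coordinates are not known beforehand to make sense. *)
Lemma cinv_box_closed : closed (cinv i @` box x0 (3 / 2 * r)).
Proof.
have r0 := r_gt0.
apply: compact_closed; first exact: carrier_hausdorff.
apply: continuous_compact; last by apply: box_compact; rewrite ?mulr_ge0 ?divr_ge0 ?(ltW r_gt0).
apply: continuous_in_subspaceT => x; rewrite inE => bx.
by apply/cinv_continuous/box_cran; move: bx; rewrite /box /=; lra.
Qed.

(** Strict bounds with factor 2 persist for a short time by continuity. As long as they hold, the
    geodesic equation improves the factor to 3/2, and the improved bounds survive the passage to the
    limit time [u]. *)
Lemma short_geodesic_in_box c : is_geodesic c -> cdom i (c 0) ->
  box x0 r (cmap i (c 0)) -> `|velocity c i 0| <= rho ->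
  forall t, t \in `[0, 1] -> in_box_at c t.
Proof.
move=> gc c0 b0 v0.
have [r0 rho0] := (r_gt0, rho_gt0); have [rr r2 rC] := And3 rho_r rho_2 rho_C.
have [[J [oJ J01 smc]] _] := gc.
have oU : open (curve_dom c J i) by exact: curve_dom_open.
pose P t := [/\ cdom i (c t), `|cmap i (c t) - x0| < 2 * r & `|velocity c i t| < 2 * rho].
have Pbox t : P t -> in_box_at c t by move=> [? ? ?]; split => //; exact: ltW.
suff H t : 0 <= t <= 1 -> P t by move=> t; rewrite in_itv /= => /H/Pbox.
move: t; apply: real_induction => u /andP[u0 u1]; last first.
  move=> [cu bu vu].
  have Uu : curve_dom c J i u by split=> //; apply: J01; rewrite /= in_itv /= u0 ltW.
  near=> t; split.
  - by have [] : curve_dom c J i t by near: t; exact: open_nbhs_nbhs.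
  - near: t; have := curve_continuous smc Uu => /cvgrPdist_lt.
    have e0 : 0 < 2 * r - `|cmap i (c u) - x0| by rewrite subr_gt0.
    move=> /(_ _ e0); apply: filterS => t; rewrite /= distrC.
    exact: dist_triangle_lt.
  - near: t; have := velocity_continuous smc Uu => /cvgrPdist_lt.
    have e0 : 0 < 2 * rho - `|velocity c i u| by rewrite subr_gt0.
    move=> /(_ _ e0); apply: filterS => t; rewrite /= distrC.
    exact: norm_triangle_lt.
move=> Pu; have [uE|un0] := eqVneq u 0.
  have [rr2 rho2] : r < 2 * r /\ rho < 2 * rho by split; lra.
  by rewrite uE; split=> //; [exact: le_lt_trans b0 rr2|exact: le_lt_trans v0 rho2].
have {un0 u0}u0 : 0 < u by rewrite lt_def un0.
have Ut t : 0 <= t < u -> curve_dom c J i t.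
  move=> /[dup] /Pu[ct _ _] /andP[t0 tu]; split=> //; apply: J01.
  by rewrite /= in_itv /= t0 (le_trans (ltW tu)).
have sub t s : 0 <= t < u -> s \in `[0, t] -> 0 <= s < u.
  by move=> /andP[t0 tu]; rewrite in_itv /= => /andP[-> st]; rewrite (le_lt_trans st).
have vb t : 0 <= t < u -> `|velocity c i t| <= 3 / 2 * rho.
  move=> tu; apply/normrV_leP => [|d]; first lra.
  have acc s : s \in `[0, t] -> `|derive1 (velocity c i) s 0 d| <= 16 * C * rho ^+ 2.
    move=> /(sub _ _ tu) su; apply: geodesic_acceleration_bound => //; last exact/Pbox/Pu.
    by move: su; rewrite in_itv /=; case/andP => -> su /=; lra.
  have [t0 t1] : 0 <= t /\ t <= 1 by move: tu => /andP[? ?]; split; lra.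
  have z : 0 \in `[0, t] by rewrite in_itv /= lexx.
  have w : t \in `[0, t] by rewrite in_itv /= lexx t0.
  have := mean_value_ineq (fun s st => is_derive_velocity smc d (Ut _ (sub _ _ tu st))) acc z w.
  rewrite subr0 (ger0_norm t0) => h.
  have h2 : 16 * C * rho ^+ 2 * t <= 1 / 4 * rho.
    apply: (@le_trans _ _ (16 * C * rho ^+ 2)).
      by rewrite ler_piMr// !mulr_ge0// ltW.
    have : 64 * C * rho * rho <= rho by rewrite ler_piMl// ltW.
    lra.
  have h3 := le_trans (normrV_entry (velocity c i 0) d) v0.
  by apply: (norm_triangle_le (le_trans h h2) h3); lra.
have xb t : 0 <= t < u -> box x0 (3 / 2 * r) (cmap i (c t)).
  move=> tu; have r320 : 0 <= 3 / 2 * r by lra.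
  apply: (normrV_distP r320) => d.
  have vel s : s \in `[0, t] -> `|velocity c i s 0 d| <= 2 * rho.
    by move=> /(sub _ _ tu)/Pu[_ _ /ltW]; apply: le_trans; exact: normrV_entry.
  have [t0 t1] : 0 <= t /\ t <= 1 by move: tu => /andP[? ?]; split; lra.
  have z : 0 \in `[0, t] by rewrite in_itv /= lexx.
  have w : t \in `[0, t] by rewrite in_itv /= lexx t0.
  have := mean_value_ineq (fun s st => is_derive_curve smc d (Ut _ (sub _ _ tu st))) vel z w.
  rewrite subr0 (ger0_norm t0) => h.
  have h2 : 2 * rho * t <= 2 * rho by rewrite ler_piMr//; lra.
  have h3 := le_trans (normrV_entryB (cmap i (c 0)) x0 d) b0.
  by apply: (dist_triangle_le (le_trans h h2) h3); lra.
have Ju : J u by apply: J01; rewrite /= in_itv /= u1 ltW.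
(* If [c u] were outside this closed set, so would be [c t] for some earlier [t], against [xb]. *)
have [p bp cp] : (cinv i @` box x0 (3 / 2 * r)) (c u).
  apply: contrapT => nK.
  have : \forall t \near u, ~ (cinv i @` box x0 (3 / 2 * r)) (c t).
    have oK : open (~` (cinv i @` box x0 (3 / 2 * r))).
      by rewrite openC; exact: cinv_box_closed.
    exact: (smc.1 _ Ju _ (open_nbhs_nbhs (conj oK nK))).
  move=> /(near_left_ex u0)[t tu]; apply.
  by exists (cmap i (c t)); [exact: xb|rewrite cmapK//; case: (Pu _ tu)].
have r32 : 3 / 2 * r < 2 * r by lra.
have e0 : 0 < 1 / 2 * rho by lra.
have rho32 : 3 / 2 * rho <= 2 * rho - 1 / 2 * rho by lra.
have bp2 : box x0 (2 * r) p by exact: le_trans bp (ltW r32).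
have [dp mp] := chart_point (box_cran bp2); rewrite cp in dp mp.
split=> //; first by rewrite mp; exact: le_lt_trans bp r32.
have Uu : curve_dom c J i u by [].
rewrite ltNge; apply/negP => vu.
(* Velocities before [u] are at most [3 / 2 * rho]; continuity adds less than [rho / 2]. *)
have : \forall t \near u, `|velocity c i u - velocity c i t| < 1 / 2 * rho.
  by have := velocity_continuous smc Uu => /cvgrPdist_lt/(_ _ e0).
move=> /(near_left_ex u0)[t /vb ht1 ht2].
have : `|velocity c i u| < 2 * rho.
  by apply: norm_triangle_lt (lt_le_trans ht2 _); rewrite lerBrDr -lerBrDl (le_trans ht1).
by rewrite ltNge vu.
Unshelve. all: by end_near. Qed.

Lemma geodesic_acceleration_lipschitz c e t d (dx dv : R) :
  is_geodesic c -> is_geodesic e ->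
  t \in `[0, 1] -> in_box_at c t -> in_box_at e t ->
  `|cmap i (c t) - cmap i (e t)| <= dx ->
  `|velocity c i t - velocity e i t| <= dv ->
  `|derive1 (velocity c i) t 0 d - derive1 (velocity e i) t 0 d| <=
    16 * C * rho ^+ 2 * dx + 16 * C * rho * dv.
Proof.
move=> gc ge t01 [ct bct vct] [et bet vet] hx hv.
have [dx0 dv0] : 0 <= dx /\ 0 <= dv.
  by split; [apply: le_trans hx|apply: le_trans hv].
have vc a := le_trans (normrV_entry (velocity c i t) a) vct.
have ve a := le_trans (normrV_entry (velocity e i t) a) vet.
have hv' a : `|velocity c i t 0 a - velocity e i t 0 a| <= dv.
  by apply: le_trans hv; exact: normrV_entryB.
have ch a b : `|christoffel i (cmap i (c t)) d a b - christoffel i (cmap i (e t)) d a b|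
    <= C * dx.
  by apply: le_trans (christoffel_lipschitz _ _ _ bct bet) _; rewrite ler_wpM2l.
have chb a b := christoffel_bound d a b bet.
have h := quadratic_lipschitz C_ge0 (ltW rho_gt0) ch chb vc ve hv'.
apply: le_trans h; rewrite le_eqVlt; apply/orP; left; apply/eqP.
by congr (`|_ - _|); exact: geodesic_acceleration.
Qed.

(** This replaces continuity of the exponential map. Let [S] be the largest difference of
    velocities: positions differ by at most [dx + S], so accelerations differ by at most
    [(dx + S) / 8 + S / 4], and integrating gives [S <= dv + dx / 8 + 3 / 8 * S], where [S] is
    absorbed on the left. *)
Lemma geodesic_endpoint_lipschitz c e : is_geodesic c -> is_geodesic e ->
  (forall t, t \in `[0, 1] -> in_box_at c t) ->
  (forall t, t \in `[0, 1] -> in_box_at e t) ->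
  `|cmap i (c 1) - cmap i (e 1)| <=
    2 * `|cmap i (c 0) - cmap i (e 0)| + 2 * `|velocity c i 0 - velocity e i 0|.
Proof.
have fin (S dx dv X Y : R) : X <= 1 / 8 * (dx + S) -> Y <= 1 / 4 * S ->
    S <= dv + (X + Y) -> 0 <= S -> 0 <= dx -> dx + S <= 2 * dx + 2 * dv.
  by move=> *; lra.
move=> gc ge bc be.
have [[J [oJ J01 smc]] _] := gc.
have [[J' [oJ' J01' sme]] _] := ge.
have Uc (t : R) : t \in `[0, 1] -> curve_dom c J i t.
  by move=> t01; split; [exact: J01|case: (bc _ t01)].
have Ue (t : R) : t \in `[0, 1] -> curve_dom e J' i t.
  by move=> t01; split; [exact: J01'|case: (be _ t01)].
have cont : {within `[0, 1], continuous (fun t => `|velocity c i t - velocity e i t|)}.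
  apply: continuous_in_subspaceT => t; rewrite inE => t01.
  apply: continuous_comp; last exact: norm_continuous.
  by apply: continuousB; [exact: (velocity_continuous smc (Uc _ t01))
    |exact: (velocity_continuous sme (Ue _ t01))].
have [u u01 uM] := EVT_max ler01 cont.
pose S := `|velocity c i u - velocity e i u|.
pose dv := `|velocity c i 0 - velocity e i 0|.
pose dx := `|cmap i (c 0) - cmap i (e 0)|.
change (`|cmap i (c 1) - cmap i (e 1)| <= 2 * dx + 2 * dv).
have z01 : (0 : R) \in `[0, 1] by rewrite in_itv /= lexx ler01.
have o01 : (1 : R) \in `[0, 1] by rewrite in_itv /= lexx ler01.
have abs1 (t : R) : t \in `[0, 1] -> `|t - 0| <= 1.
  by rewrite in_itv /= subr0 => /andP[t0 t1]; rewrite ger0_norm.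
have S0 : 0 <= S by exact: normr_ge0.
have xb (t : R) : t \in `[0, 1] -> `|cmap i (c t) - cmap i (e t)| <= dx + S.
  move=> t01; have dxS : 0 <= dx + S by apply: addr_ge0 (normr_ge0 _) S0.
  apply: (normrV_distP dxS) => d.
  have D (s : R) : s \in `[0, 1] -> is_derive s 1
      ((fun s => cmap i (c s) 0 d) - (fun s => cmap i (e s) 0 d))
      (velocity c i s 0 d - velocity e i s 0 d).
    by move=> s01; apply: is_deriveB; [exact: (is_derive_curve smc d (Uc _ s01))
     |exact: (is_derive_curve sme d (Ue _ s01))].
  have Db (s : R) : s \in `[0, 1] -> `|velocity c i s 0 d - velocity e i s 0 d| <= S.
    by move=> /uM; apply: le_trans; exact: normrV_entryB.
  have h := mean_value_ineq D Db z01 t01.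
  have h0 := normrV_entryB (cmap i (c 0)) (cmap i (e 0)) d.
  apply: (norm_triangle_le h h0).
  by rewrite addrC lerD2l ler_piMr// abs1.
have vb : S <= dv + (16 * C * rho ^+ 2 * (dx + S) + 16 * C * rho * S).
  pose B := 16 * C * rho ^+ 2 * (dx + S) + 16 * C * rho * S.
  have D d (s : R) : s \in `[0, 1] -> is_derive s 1
      ((fun s => velocity c i s 0 d) - (fun s => velocity e i s 0 d))
      (derive1 (velocity c i) s 0 d - derive1 (velocity e i) s 0 d).
    by move=> s01; apply: is_deriveB; [exact: (is_derive_velocity smc d (Uc _ s01))
     |exact: (is_derive_velocity sme d (Ue _ s01))].
  have Db d (s : R) : s \in `[0, 1] ->
    `|derive1 (velocity c i) s 0 d - derive1 (velocity e i) s 0 d| <= B.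
    move=> s01; exact: (geodesic_acceleration_lipschitz d gc ge s01 (bc _ s01)
      (be _ s01) (xb _ s01) (uM _ s01)).
  have B0 : 0 <= B by apply: le_trans (Db 0 0 z01).
  have dvB : 0 <= dv + B by apply: addr_ge0 (normr_ge0 _) B0.
  apply: (normrV_distP dvB) => d.
  have h := mean_value_ineq (D d) (Db d) z01 u01.
  have h0 := normrV_entryB (velocity c i 0) (velocity e i 0) d.
  apply: (norm_triangle_le h h0).
  by rewrite addrC lerD2l ler_piMr// abs1.
apply: le_trans (xb 1 o01) _.
have dx0 : 0 <= dx by exact: normr_ge0.
have rho0 := rho_gt0.
have a1 : 16 * C * rho <= 1 / 4 by have := rho_C; lra.
have a2 : 16 * C * rho ^+ 2 <= 1 / 8.
  have : 16 * C * rho * (2 * rho) <= 1 / 4 * 1.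
    by apply: ler_pM => //; rewrite ?rho_2 ?mulr_ge0// ltW.
  lra.
have b1 : 16 * C * rho ^+ 2 * (dx + S) <= 1 / 8 * (dx + S).
  by rewrite ler_wpM2r// addr_ge0.
have b2 : 16 * C * rho * S <= 1 / 4 * S by rewrite ler_wpM2r.
exact: fin b1 b2 vb S0 dx0.
Qed.

End Geodesics.

(** * Normal field and curvature in a chart *)

Section Frame.
Context {R : realType} {A : oriented_surface R}.

(** [P] and [Q] are the components of the covector [g(T, .)]; the normal is this covector turned by
    a right angle and divided by the square root of the determinant of [g]. The scale comes from the
    Gram determinant: the coordinate area [d] of the frame satisfies [d ^+ 2 * det g = 1], and the
    orientation selects the positive root. *)
Lemma oriented_frame_unique (g00 g01 g11 T0 T1 N0 N1 D : R) :
  let P := T0 * g00 + T1 * g01 in let Q := T0 * g01 + T1 * g11 in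
  P * T0 + Q * T1 = 1 -> P * N0 + Q * N1 = 0 ->
  (N0 * g00 + N1 * g01) * N0 + (N0 * g01 + N1 * g11) * N1 = 1 ->
  0 < T0 * N1 - N0 * T1 ->
  D = Num.sqrt (g00 * g11 - g01 * g01)^-1 ->
  [/\ N0 = - (Q * D), N1 = P * D & D ^+ 2 * (g00 * g11 - g01 * g01) = 1].
Proof.
move=> P Q TT TN NN d0 DE.
pose d := T0 * N1 - N0 * T1.
have N1E : N1 = P * d.
  have : (P * T0 + Q * T1) * N1 - T1 * (P * N0 + Q * N1) = P * d by rewrite /d; ring.
  by rewrite TT TN mulr0 subr0 mul1r.
have N0E : N0 = - (Q * d).
  have : (P * T0 + Q * T1) * N0 - T0 * (P * N0 + Q * N1) = - (Q * d) by rewrite /d; ring.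
  by rewrite TT TN mulr0 subr0 mul1r.
have dd : d ^+ 2 * (g00 * g11 - g01 * g01) = 1.
  have : (N0 * g00 + N1 * g01) * N0 + (N0 * g01 + N1 * g11) * N1 =
    d ^+ 2 * (g00 * g11 - g01 * g01) * (P * T0 + Q * T1).
    by rewrite N0E N1E /P /Q; ring.
  by rewrite TT mulr1 NN => <-.
have Dd : D = d.
  have -> : D = Num.sqrt (d ^+ 2).
    rewrite DE; congr Num.sqrt; apply: (mulIf (x := g00 * g11 - g01 * g01)).
      by apply/eqP => E; move: dd; rewrite E mulr0 => /eqP; rewrite eq_sym oner_eq0.
    rewrite dd mulVf//.
    by apply/eqP => E; move: dd; rewrite E mulr0 => /eqP; rewrite eq_sym oner_eq0.
  by rewrite sqrtr_sqr gtr0_norm.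
by rewrite Dd -N1E -N0E.
Qed.

Lemma gdotE (i : chart A) x v w : gdot i x v w =
  (v 0 0 * metric i x 0 0 + v 0 1 * metric i x 1 0) * w 0 0 +
  (v 0 0 * metric i x 0 1 + v 0 1 * metric i x 1 1) * w 0 1.
Proof. by rewrite /gdot mxE sum_ord2 !mxE !sum_ord2. Qed.

Lemma det_col_mx (v w : 'rV[R]_2) :
  \det (col_mx v w : 'M[R]_2) = v 0 0 * w 0 1 - w 0 0 * v 0 1.
Proof.
have u j : (col_mx v w : 'M[R]_2) 0 j = v 0 j.
  by rewrite -[RHS](col_mxEu v w); congr (col_mx _ _ _ _); exact/val_inj.
have d j : (col_mx v w : 'M[R]_2) 1 j = w 0 j.
  by rewrite -[RHS](col_mxEd v w); congr (col_mx _ _ _ _); exact/val_inj.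
by rewrite det_mx22 !u !d; ring.
Qed.

End Frame.

Section NormalCurvature.
Context {R : realType} {A : oriented_surface R}.
Variables (Gam : R -> A) (J : set R) (i : chart A).
Hypothesis smoothG : smooth_curve J Gam.
Local Notation U := (curve_dom Gam J i).
Local Notation T s a := (velocity Gam i s 0 a).
Local Notation g s a b := (metric i (cmap i (Gam s)) a b).
Local Notation detg s := (\det (metric i (cmap i (Gam s)))).

(** Closed formulas in the chart, from which the given [N] and [kappa] inherit continuity on
    [[0, L]]. *)
Definition normal_scale s := Num.sqrt (detg s)^-1.
Definition normal0 s := - ((T s 0 * g s 0 1 + T s 1 * g s 1 1) * normal_scale s).
Definition normal1 s := (T s 0 * g s 0 0 + T s 1 * g s 1 0) * normal_scale s.
(** The Riemannian area form evaluated on [T] and the covariant acceleration; the square root of the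
    determinant is written as the determinant times [normal_scale]. *)
Definition curvature_fun s :=
  (T s 0 * cov_accel Gam i s 0 1 - cov_accel Gam i s 0 0 * T s 1)
    * detg s * normal_scale s.

Lemma normal_curvatureE L N kappa s :
  unit_speed_embedded L Gam -> is_unit_normal L Gam N ->
  is_curvature L Gam N kappa -> s \in `[0, L] -> cdom i (Gam s) ->
  [/\ N s i 0 0 = normal0 s, N s i 0 1 = normal1 s & kappa s = curvature_fun s].
Proof.
move=> [_ unitG _] nN ck s0L cs.
have xi : cran i (cmap i (Gam s)) by exists (Gam s).
have [TN NN] := nN _ _ s0L cs; rewrite det_col_mx => d0.
have TT := unitG _ _ s0L cs.
have acc := ck _ _ s0L cs.
have sym : g s 1 0 = g s 0 1 by rewrite -[in RHS](metric_sym xi) mxE.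
have detE : detg s = g s 0 0 * g s 1 1 - g s 0 1 * g s 0 1 by rewrite det_mx22 sym.
rewrite !gdotE !sym in TN NN TT.
have [N0 N1 DD] := oriented_frame_unique TT TN NN d0 (erefl _).
rewrite -detE -/(normal_scale s) in N0 N1 DD.
have a0 : cov_accel Gam i s 0 0 = kappa s * N s i 0 0 by rewrite acc mxE.
have a1 : cov_accel Gam i s 0 1 = kappa s * N s i 0 1 by rewrite acc mxE.
rewrite /normal0 /normal1 /curvature_fun sym; split=> //.
rewrite a0 a1 N0 N1.
(* The two units are then expanded as the squared length of [T] and as the Gram identity [DD], after
   which the equality is polynomial. *)
transitivity (kappa s * 1 * 1); first by rewrite !mulr1.
rewrite -{1}TT -{1}DD; ring.
Qed.

Lemma chart_fun_continuous (F : 'rV[R]_2 -> R) s : smooth_on (cran i) F -> U s ->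
  {for s, continuous (fun s => F (cmap i (Gam s)))}.
Proof.
move=> sF Us; apply: (@continuous_comp _ _ _ (cmap i \o Gam) F).
  exact: (curve_continuous smoothG Us).
apply: Ck_on_continuous (sF 0) _.
by case: Us => _ cs; exists (Gam s).
Qed.

Lemma velocity_entry_continuous s a : U s -> {for s, continuous (fun s => T s a)}.
Proof. by move=> Us; apply: entry_continuous_at; exact: (velocity_continuous smoothG Us). Qed.

Lemma normal_scale_continuous s : U s -> {for s, continuous normal_scale}.
Proof.
move=> Us; apply: continuous_comp; last exact: sqrt_continuous.
apply: continuousV; last exact: (chart_fun_continuous (metric_det_smooth i) Us).
by apply: metric_det_neq0; case: Us => _ cs; exists (Gam s).
Qed.

Lemma normal0_continuous s : U s -> {for s, continuous normal0}.
Proof.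
move=> Us; apply: continuousN; apply: continuousM; last exact: normal_scale_continuous.
by apply: continuousD; apply: continuousM; (exact: velocity_entry_continuous ||
  exact: (chart_fun_continuous (metric_entry_smooth i _ _) Us)).
Qed.

Lemma normal1_continuous s : U s -> {for s, continuous normal1}.
Proof.
move=> Us; apply: continuousM; last exact: normal_scale_continuous.
by apply: continuousD; apply: continuousM; (exact: velocity_entry_continuous ||
  exact: (chart_fun_continuous (metric_entry_smooth i _ _) Us)).
Qed.

Lemma cov_accel_continuous s d : U s ->
  {for s, continuous (fun s => cov_accel Gam i s 0 d)}.
Proof.
move=> Us.
rewrite (_ : (fun s => _) = (fun s => derive1 (velocity Gam i) s 0 d
    + \sum_(a < 2) \sum_(b < 2) christoffel i (cmap i (Gam s)) d a b
        * velocity Gam i s 0 a * velocity Gam i s 0 b)); last first.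
  by apply/funext => u; rewrite mxE.
apply: continuousD.
  apply: (@entry_continuous_at _ _ _ _ (derive1 (velocity Gam i))).
  exact: (acceleration_continuous smoothG Us).
have term a b : {for s, continuous (fun s => christoffel i (cmap i (Gam s)) d a b
        * velocity Gam i s 0 a * velocity Gam i s 0 b)}.
  do 2 (apply: continuousM; last exact: velocity_entry_continuous).
  exact: (chart_fun_continuous (christoffel_smooth i d a b) Us).
rewrite (_ : (fun s => _) = (fun s =>
  christoffel i (cmap i (Gam s)) d 0 0 * velocity Gam i s 0 0 * velocity Gam i s 0 0
  + christoffel i (cmap i (Gam s)) d 0 1 * velocity Gam i s 0 0 * velocity Gam i s 0 1
  + (christoffel i (cmap i (Gam s)) d 1 0 * velocity Gam i s 0 1 * velocity Gam i s 0 0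
  + christoffel i (cmap i (Gam s)) d 1 1 * velocity Gam i s 0 1 * velocity Gam i s 0 1))).
  by apply: continuousD; apply: continuousD; exact: term.
by apply/funext => u; rewrite !sum_ord2.
Qed.

Lemma curvature_fun_continuous s : U s -> {for s, continuous curvature_fun}.
Proof.
move=> Us; apply: continuousM; last exact: normal_scale_continuous.
apply: continuousM; last exact: (chart_fun_continuous (metric_det_smooth i) Us).
by apply: continuousB; apply: continuousM; (exact: velocity_entry_continuous
 || exact: cov_accel_continuous).
Qed.

End NormalCurvature.

(** * Uniform bounds along the strip *)

Lemma uniform_bound (R : realType) (I : finType) (P : I -> R -> Prop) :
  (forall k M M', M <= M' -> P k M -> P k M') ->
  (forall k, exists2 M, 0 <= M & P k M) ->
  exists2 M, 0 <= M & forall k, P k M.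
Proof.
move=> mono /(_ _)/cid2-/all_sig2[F F0 FP].
exists (\sum_k F k); first exact: sumr_ge0.
move=> k; apply: mono (FP k); rewrite (bigD1 k)//= lerDl.
exact: sumr_ge0.
Qed.

Section StripBounds.
Context {R : realType} {A : oriented_surface R}.
Variables (K : A -> R) (L : R) (Gam : R -> A) (N : R -> @tangent R A)
  (kappa : R -> R).
Hypothesis HK : is_gauss_curvature K.
Hypothesis HGam : unit_speed_embedded L Gam.
Hypothesis HN : is_unit_normal L Gam N.
Hypothesis Hkappa : is_curvature L Gam N kappa.

(** Enlarging [M] weakens the bounds and strengthens the premise [eps * M <= 1], so local constants
    can be merged into one that does not depend on [eps]. The modulus of continuity in [s] is
    uniform in [t], as joint continuity of the Jacobi function requires. *)
Definition strip_bounds (M s : R) :=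
  [/\ `|kappa s| <= M,
      forall eta, 0 < eta -> \forall s' \near s, s' \in `[0, L] ->
        `|kappa s' - kappa s| <= eta
    & forall eps, 0 < eps -> eps * M <= 1 ->
      forall Leps, is_strip_map L Gam N eps Leps ->
        (forall t, t \in `[-1, 1] -> `|K (Leps (s, t))| <= M) /\
        forall eta, 0 < eta -> \forall s' \near s, s' \in `[0, L] ->
          forall t, t \in `[-1, 1] ->
          `|K (Leps (s', t)) - K (Leps (s, t))| <= eta].

Lemma local_christoffel_bound (i : chart A) x0 (r : R) :
  0 <= r -> box x0 r `<=` cran i ->
  exists2 C, 0 <= C & forall d a b x, box x0 r x ->
    `|christoffel i x d a b| <= C /\ forall y, box x0 r y ->
    `|christoffel i x d a b - christoffel i y d a b| <= C * `|x - y|.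
Proof.
move=> r0 sub.
pose P (k : 'I_2 * 'I_2 * 'I_2) (C : R) := forall x, box x0 r x ->
    `|christoffel i x k.1.1 k.1.2 k.2| <= C /\ forall y, box x0 r y ->
    `|christoffel i x k.1.1 k.1.2 k.2 - christoffel i y k.1.1 k.1.2 k.2| <= C * `|x - y|.
have [||C C0 CP] := @uniform_bound R _ P.
- move=> k M M' MM' PM x bx; have [h1 h2] := PM x bx; split; first exact: le_trans MM'.
  by move=> y yb; apply: le_trans (h2 y yb) _; rewrite ler_wpM2r.
- move=> k; exact: (Ck_on_lipschitz (christoffel_smooth i _ _ _ 1) r0 sub).
by exists C => // d a b x bx; exact: (CP (d, a, b)).
Qed.

Lemma exp_in_box (i : chart A) x0 (r C rho Nb eps : R) Leps s t :
  0 < r -> box x0 (2 * r) `<=` cran i -> 0 <= C ->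
  (forall d a b x, box x0 (2 * r) x -> `|christoffel i x d a b| <= C) ->
  0 < rho -> 4 * rho <= r -> 2 * rho <= 1 -> 64 * C * rho <= 1 ->
  0 < eps -> eps * Nb <= rho -> is_strip_map L Gam N eps Leps ->
  s \in `[0, L] -> t \in `[-1, 1] -> cdom i (Gam s) ->
  box x0 r (cmap i (Gam s)) -> `|N s i| <= Nb ->
  exists c, [/\ is_geodesic c, c 0 = Gam s, velocity c i 0 = (eps * t) *: N s i,
    c 1 = Leps (s, t) & forall u, u \in `[0, 1] -> in_box_at i x0 r rho c u].
Proof.
move=> r0 sub C0 Cb rho0 rhor rho2 rhoC eps0 epsN strip s0L t1 cs bs Ns.
have [c [gc c0 vc c1]] := strip s t s0L t1.
have v0 := vc i cs.
exists c; split=> //.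
apply: (short_geodesic_in_box r0 sub C0 Cb rho0 rhor rho2 rhoC gc); rewrite ?c0//.
rewrite v0 normrZ normrM (gtr0_norm eps0) (le_trans _ epsN)// -mulrA ler_wpM2l ?(ltW eps0)//.
rewrite (le_trans _ Ns)// ler_piMl//.
by move: t1; rewrite in_itv /= ler_norml.
Qed.

Lemma local_strip_bounds s0 : s0 \in `[0, L] ->
  exists M0, \forall s \near s0, s \in `[0, L] ->
    forall M, M0 <= M -> strip_bounds M s.
Proof.
move=> s0L.
have sum_le (a b c m : R) : 0 <= a -> 0 <= b -> 0 <= c -> a + 1 + b + 1 + c <= m ->
    [/\ a + 1 <= m, b <= m, 1 <= m & c <= m].
  by move=> *; split; lra.
have [i ci] := cdom_cover (Gam s0).
have [[J [oJ JL smG]] _ _] := HGam.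
pose U := curve_dom Gam J i.
have oU : open U by exact: curve_dom_open.
have Us0 : U s0 by split=> //; exact: JL.
pose x0 := cmap i (Gam s0).
have [r r0 sub] : exists2 r, 0 < r & box x0 (2 * r) `<=` cran i.
  have : nbhs x0 (cran i).
    by apply: open_nbhs_nbhs; split; [exact: cran_open|exists (Gam s0)].
  move=> /nbhs_ballP[e /= e0 eb]; exists (e / 4); first exact: divr_gt0.
  move=> x; rewrite /box /= => xe; apply: eb; rewrite -ball_normE /= distrC.
  by apply: le_lt_trans xe _; lra.
have r20 : 0 <= 2 * r by rewrite mulr_ge0// ltW.
have [C C0 CP] := local_christoffel_bound r20 sub.
have Cb d a b x bx := (CP d a b x bx).1.
have Cl d a b x y bx bY := (CP d a b x bx).2 y bY.
have [Mk Mk0 MkP] := Ck_on_lipschitz (gauss_chart_smooth i 1) r20 sub.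
have [rho [rho0 rhor rho2 rhoC]] :
    exists rho, [/\ 0 < rho, 4 * rho <= r, 2 * rho <= 1 & 64 * C * rho <= 1].
  (* One entry for each smallness condition; the added 1 covers [C = 0]. *)
  exists (Num.min (r / 4) (Num.min (1 / 2) (64 * C + 1)^-1)).
  have C1 : 0 < 64 * C + 1 by lra.
  have m1 : Num.min (r / 4) (Num.min (1 / 2) (64 * C + 1)^-1) <= r / 4.
    by rewrite ge_min lexx.
  have m2 : Num.min (r / 4) (Num.min (1 / 2) (64 * C + 1)^-1) <= 1 / 2.
    by rewrite !ge_min lexx orbT.
  have m3 : Num.min (r / 4) (Num.min (1 / 2) (64 * C + 1)^-1) <= (64 * C + 1)^-1.
    by rewrite !ge_min lexx !orbT.
  have m0 : 0 < Num.min (r / 4) (Num.min (1 / 2) (64 * C + 1)^-1).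
    by rewrite !lt_min invr_gt0 C1 !divr_gt0.
  split=> //; [lra|lra|].
  have : 64 * C * Num.min (r / 4) (Num.min (1 / 2) (64 * C + 1)^-1)
     <= (64 * C + 1) * (64 * C + 1)^-1.
    by apply: ler_pM => //; [lra|exact: ltW|lra].
  by rewrite mulfV// gt_eqF.
have nE s := normal_curvatureE (i := i) HGam HN Hkappa (s := s).
pose n0 := normal0 Gam i; pose n1 := normal1 Gam i; pose k := curvature_fun Gam i.
have cn0 s : U s -> {for s, continuous n0} by exact: normal0_continuous.
have cn1 s : U s -> {for s, continuous n1} by exact: normal1_continuous.
have ck s : U s -> {for s, continuous k} by exact: curvature_fun_continuous.
have cg s : U s -> {for s, continuous (cmap i \o Gam)} by exact: curve_continuous.
pose Nb := `|n0 s0| + `|n1 s0| + 1.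
have Nb0 : 0 < Nb by rewrite /Nb ltr_wpDl// addr_ge0.
(* The summands dominate, in turn, the curvature near [s0], the Gauss curvature in the box, the
   number 1 (so that [eps <= 1]), and [Nb / rho], which turns [eps * M <= 1] into
   [eps * Nb <= rho]. *)
pose M0 := `|k s0| + 1 + Mk + 1 + Nb / rho.
exists M0.
pose good s := [/\ U s, box x0 r (cmap i (Gam s)), `|k s - k s0| <= 1,
  `|n0 s - n0 s0| <= 1 & `|n1 s - n1 s0| <= 1].
have near_le (f : R -> R) (s e : R) : {for s, continuous f} -> 0 < e ->
    \forall s' \near s, `|f s' - f s| <= e.
  by move=> /cvgrPdist_le cf e0; have := cf e e0; apply: filterS => s'; rewrite distrC.
have near_le' (f : R -> 'rV[R]_2) (s e : R) : {for s, continuous f} -> 0 < e ->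
    \forall s' \near s, `|f s' - f s| <= e.
  by move=> /cvgrPdist_le cf e0; have := cf e e0; apply: filterS => s'; rewrite distrC.
have near_good : \forall s \near s0, good s.
  near=> s; split; near: s.
  - exact: open_nbhs_nbhs.
  - exact: (near_le' _ _ _ (cg _ Us0) r0).
  - exact: (near_le _ _ _ (ck _ Us0) ltr01).
  - exact: (near_le _ _ _ (cn0 _ Us0) ltr01).
  - exact: (near_le _ _ _ (cn1 _ Us0) ltr01).
have goodN s : good s -> s \in `[0, L] -> `|N s i| <= Nb.
  move=> [[_ cs] _ _ g0 g1] sL; have [N0 N1 _] := nE s sL cs.
  apply/(normrV_leP _ (ltW Nb0)); apply: ord2P.
    rewrite N0; apply: (norm_triangle_le g0 (lexx _)); rewrite addrC lerD2r lerDl.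
    exact: normr_ge0.
  rewrite N1; apply: (norm_triangle_le g1 (lexx _)); rewrite addrC lerD2r lerDr.
  exact: normr_ge0.
(* [strip_bounds M s] itself speaks of all points near [s], so [good] is needed on a neighbourhood
   of each such [s]. *)
have : \forall s \near s0, \forall s' \near s, good s' by exact: nbhs_interior near_good.
apply: filterS => s near_s sL M M0M.
have gs := nbhs_singleton near_s.
have [[Js cs] bs gk _ _] := gs.
have Us : U s by [].
have M0E : [/\ `|k s0| + 1 <= M, Mk <= M, 1 <= M & Nb / rho <= M].
  have h1 := normr_ge0 (k s0); have h2 : 0 <= Nb / rho by rewrite divr_ge0// ltW.
  exact: sum_le h1 Mk0 h2 M0M.
have [M1 M2 M3 M4] := M0E.
have M_gt0 : 0 < M by exact: lt_le_trans M3.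
split.
- have [_ _ ->] := nE s sL cs.
  by apply: (norm_triangle_le gk (lexx _)); rewrite addrC.
- move=> eta eta0; near=> s' => s'L.
  have [[_ cs'] _ _ _ _] : good s' by near: s'.
  have [_ _ ->] := nE s sL cs; have [_ _ ->] := nE s' s'L cs'.
  by near: s'; exact: (near_le _ _ _ (ck _ Us) eta0).
move=> eps eps0 epsM Leps strip.
have epsN : eps * Nb <= rho.
  have : eps * (Nb / rho) <= 1 by apply: le_trans epsM; rewrite ler_wpM2l// ltW.
  by rewrite mulrA ler_pdivrMr// mul1r.
have eps1 : eps <= 1 by apply: le_trans epsM; rewrite ler_peMr// ltW.
have getc s' t : good s' -> s' \in `[0, L] -> t \in `[-1, 1] ->
  exists c, [/\ is_geodesic c, c 0 = Gam s', velocity c i 0 = (eps * t) *: N s' i,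
    c 1 = Leps (s', t) & forall u, u \in `[0, 1] -> in_box_at i x0 r rho c u].
  move=> gs' s'L t1; have [[_ cs'] bs' _ _ _] := gs'.
  exact: (exp_in_box r0 sub C0 Cb rho0 rhor rho2 rhoC eps0 epsN strip s'L t1 cs' bs'
    (goodN _ gs' s'L)).
have o01 : (1 : R) \in `[0, 1] by rewrite in_itv /= lexx ler01.
split.
  move=> t t1; have [c [_ _ _ c1 bc]] := getc s t gs sL t1.
  have [cc bb _] := bc 1 o01.
  rewrite -c1 (HK cc); apply: le_trans M2; exact: (MkP _ bb).1.
move=> eta eta0.
(* The endpoint estimate gives [2 * e + 2 * e], from base point and normal; [Mk] is the Lipschitz
   constant of the Gauss curvature in the chart. *)
pose e := eta / (4 * (Mk + 1)).
have Mk1 : 0 < Mk + 1 by rewrite ltr_wpDl.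
have e0 : 0 < e by rewrite divr_gt0// mulr_gt0.
have eE : Mk * (2 * e + 2 * e) <= eta.
  have -> : eta = (Mk + 1) * (2 * e + 2 * e).
    by rewrite /e; field; rewrite gt_eqF.
  by rewrite ler_wpM2r ?lerDl// addr_ge0// mulr_ge0// ltW.
near=> s' => s'L t t1.
have gs' : good s' by near: s'.
have [[_ cs'] bs' _ _ _] := gs'.
have [c [gc c0 vc c1 bc]] := getc s t gs sL t1.
have [c' [gc' c0' vc' c1' bc']] := getc s' t gs' s'L t1.
have [cc bb _] := bc 1 o01; have [cc' bb' _] := bc' 1 o01.
have gx : `|cmap i (Gam s') - cmap i (Gam s)| <= e.
  by near: s'; exact: (near_le' _ _ _ (cg _ Us) e0).
have gN : `|N s' i - N s i| <= e.
  have [N0 N1 _] := nE s sL cs; have [N0' N1' _] := nE s' s'L cs'.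
  apply: (normrV_distP (ltW e0)); apply: ord2P.
    by rewrite N0 N0'; near: s'; exact: (near_le _ _ _ (cn0 _ Us) e0).
  by rewrite N1 N1'; near: s'; exact: (near_le _ _ _ (cn1 _ Us) e0).
rewrite -c1 -c1' (HK cc) (HK cc').
apply: le_trans ((MkP _ bb').2 _ bb) _; apply: le_trans eE; rewrite ler_wpM2l//.
apply: le_trans (geodesic_endpoint_lipschitz C0 Cb Cl rho0 rho2 rhoC gc' gc bc' bc) _.
rewrite c0 c0' vc vc' -scalerBr normrZ normrM (gtr0_norm eps0).
apply: lerD; rewrite ler_wpM2l//.
apply: le_trans gN; rewrite ler_piMl// mulr_ile1 ?(ltW eps0)//.
by move: t1; rewrite in_itv /= ler_norml.
Unshelve. all: by end_near. Qed.

(** Compactness of [[0, L]] as a near-covering along the filter of large [M]: what holds locally in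
    [s] for all large [M] holds on the whole segment for all large [M]. *)
Lemma uniform_strip_bounds :
  exists2 M, 0 < M & forall s, s \in `[0, L] -> strip_bounds M s.
Proof.
have cov := (near_covering_withinP _).2 ((compact_near_coveringP _).1 (@segment_compact R 0 L)).
have : \forall M \near +oo, `[0, L] `<=` strip_bounds M.
  apply: cov => s0 s0L.
  have [M0 HM0] := local_strip_bounds s0L.
  exists ([set s | s \in `[0, L] -> forall M, M0 <= M -> strip_bounds M s], [set M | M0 <= M]).
    by split; [exact: HM0|exact: (nbhs_pinfty_ge (num_real _))].
  by move=> [s M] /= [h1 h2] sL; exact: h1.
move=> H; near (pinfty_nbhs R) => M.
exists M; first by near: M; exact: (nbhs_pinfty_gt (num_real _)).
by move=> s sL; have : `[0, L] `<=` strip_bounds M; [near: M|apply].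
Unshelve. all: by end_near. Qed.

End StripBounds.

(** * The Jacobi function *)

Section PlaneMeasurability.
Context {R : realType}.

Lemma open_measurable_plane (O : set (R * R)) : open O -> measurable O.
Proof.
move=> oO.
pose sq (a b e : rat) : set (R * R) :=
  `]ratr a - ratr e, ratr a + ratr e[ `*` `]ratr b - ratr e, ratr b + ratr e[.
pose F (a b e : rat) := if `[< sq a b e `<=` O >] then sq a b e else set0.
suff -> : O = \bigcup_a \bigcup_b \bigcup_e F a b e.
  apply: bigcupT_measurable_rat => a; apply: bigcupT_measurable_rat => b.
  apply: bigcupT_measurable_rat => e; rewrite /F; case: ifPn => _ //.
  by apply: measurableX; exact: measurable_itv.
apply/seteqP; split=> [[s t] Ost|x [a _ [b _ [e _]]]]; last first.
  by rewrite /F; case: ifPn => // /asboolP; apply.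
have : nbhs (s, t) O by exact: open_nbhs_nbhs.
move=> /nbhs_ballP[d /= d0 dO].
(* A square of half-side [e] whose centre is within [e] of the point stays within [2 * e < d] of
   it. *)
have [e] : exists e : rat, ratr e \in `]0, d / 2[ by apply: rat_in_itvoo; rewrite divr_gt0.
rewrite in_itv /= => /andP[e0 ed].
have mid (u : R) : exists a : rat, u - ratr e < ratr a /\ ratr a < u + ratr e.
  have [|a] := @rat_in_itvoo R (u - ratr e) (u + ratr e); first by lra.
  by rewrite in_itv /= => /andP[]; exists a.
have [a [a1 a2]] := mid s; have [b [b1 b2]] := mid t.
exists a => //; exists b => //; exists e => //.
rewrite /F asboolT; first by split; rewrite /= in_itv /=; apply/andP; split; lra.
move=> [s' t'] [] /=; rewrite !in_itv /= => /andP[? ?] /andP[? ?].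
by apply: dO; split; rewrite /ball /= ltr_norml; apply/andP; split; lra.
Qed.

Lemma continuous_measurable_plane (D : set (R * R)) (f : R * R -> R) :
  open D -> (forall x, D x -> {for x, continuous f}) -> measurable_fun D f.
Proof.
move=> oD cf; apply: (measurability _ (RGenOpens.measurableE R)).
move=> _ [_ [a [b ->] <-]]; apply: open_measurable_plane.
rewrite openE => x [Dx fx]; rewrite /interior; apply: filterI; first exact: open_nbhs_nbhs.
by apply: (cf x Dx); apply: open_nbhs_nbhs; split=> //; exact: interval_open.
Qed.

Lemma strip_open (L : R) : open (strip L).
Proof.
rewrite openE => -[s t] [/= s0 t0].
exists (`]0, L[%classic, `]-1, 1[%classic) => //=.
by split; apply: open_nbhs_nbhs; split=> //; exact: interval_open.
Qed.

Lemma strip_measurable (L : R) : measurable (strip L).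
Proof. by apply: open_measurable_plane; exact: strip_open. Qed.

End PlaneMeasurability.

(** * Closeness to 1 and joint continuity of the Jacobi function *)

Section Jacobi.
Context {R : realType}.
Variables (L M eps : R) (kappa : R -> R) (Keps f : R * R -> R).
Hypothesis M_gt0 : 0 < M.
Hypothesis eps_gt0 : 0 < eps.
Hypothesis eps_half : eps <= 1 / 2.
Hypothesis epsM : eps * M <= 1 / 16.
Hypothesis kappa_bound : forall s : R, s \in `[0, L] -> `|kappa s| <= M.
Hypothesis Keps_bound : forall s t : R, s \in `[0, L] -> t \in `[-1, 1] ->
  `|Keps (s, t)| <= M.
Hypothesis jacobi : is_jacobi_solution L eps kappa Keps f.

Lemma jacobi_derive (s : R) : s \in `[0, L] -> exists f' : R -> R,
  [/\ forall t : R, t \in `]-1, 1[ -> is_derive t 1 (fun t => f (s, t)) (f' t),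
      forall t : R, t \in `]-1, 1[ ->
        is_derive t 1 f' (- (eps ^+ 2 * Keps (s, t) * f (s, t))),
      f (s, 0) = 1 & f' 0 = - (eps * kappa s)].
Proof.
move=> sL; have [f' [d1 d2 f0 f'0]] := jacobi sL.
have sub (t : R) : t \in `]-1, 1[ -> t \in `[-1, 1] by exact: subset_itv_oo_cc.
have nb (t : R) : t \in `]-1, 1[ -> nbhs t `[-1, 1]%classic.
  move=> /near_in_itvoo; apply: filterS => u; exact: subset_itv_oo_cc.
exists f'; split=> // t t1.
  by apply: (is_derive_within_nbhs (nb _ t1)); exact/d1/sub.
by apply: (is_derive_within_nbhs (nb _ t1)); exact/d2/sub.
Qed.

Lemma eps2M : 0 <= eps ^+ 2 * M <= eps * M * (1 / 2).
Proof.
have [e0 m0] := (eps_gt0, M_gt0).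
have h : 0 <= eps * M by rewrite mulr_ge0// ltW.
rewrite mulr_ge0 ?sqr_ge0 ?(ltW m0)//=.
by rewrite expr2 mulrAC ler_wpM2l.
Qed.

(** The function [f - 1] vanishes at 0 with slope at most [eps * M] and solves the equation with
    forcing at most [eps ^+ 2 * M]; the second-order bound gives [2 * (eps * M + eps ^+ 2 * M)]. *)
Lemma jacobi_near_one (s t : R) : s \in `[0, L] -> t \in `]-1, 1[ ->
  `|f (s, t) - 1| <= 4 * M * eps.
Proof.
move=> sL t1; have [f' [d1 d2 f0 f'0]] := jacobi_derive sL.
have /andP[e2M0 e2M] := eps2M; have eM := epsM; have [e0 m0] := (eps_gt0, M_gt0).
have n1 : `|1 : R| <= 1 by rewrite normr1.
have bnd (u : R) : u \in `]-1, 1[ -> `|- (eps ^+ 2 * Keps (s, u) * f (s, u))| <=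
    eps ^+ 2 * M * `|f (s, u) - 1| + eps ^+ 2 * M.
  move=> u1; rewrite normrN 2!normrM [`|eps ^+ 2|]ger0_norm ?sqr_ge0//.
  rewrite -[X in _ + X]mulr1 -mulrDr; apply: ler_pM => //.
  - by rewrite mulr_ge0// sqr_ge0.
  - by rewrite ler_wpM2l ?sqr_ge0// Keps_bound//; exact: subset_itv_oo_cc.
  - exact: (norm_triangle_le (lexx _) n1 (lexx _)).
have d1' (u : R) : u \in `]-1, 1[ -> is_derive u 1 (fun t => f (s, t) - 1) (f' u).
  by move=> /d1 h; rewrite -[f' u]subr0; apply: is_deriveB.
have := second_order_bound (q := 0) (p := eps * M) d1' d2 bnd.
rewrite f0 subrr normr0 f'0 normrN normrM (gtr0_norm e0) => /(_ (lexx 0)).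
have a1 : eps ^+ 2 * M <= 1 / 2 by lra.
have kb : eps * `|kappa s| <= eps * M by rewrite ler_wpM2l ?kappa_bound// ltW.
move=> /(_ kb e2M0 a1 e2M0 _ t1) h; apply: le_trans h _.
lra.
Qed.

(** The difference of two columns [f (s', .)] and [f (s, .)] solves the equation at [s'] with a
    forcing proportional to the difference of the curvatures, hence is small uniformly in [t];
    continuity along the single column at [s] completes the argument. *)
Lemma jacobi_continuous (s t : R) :
  (forall eta : R, 0 < eta -> \forall s' \near s, s' \in `[0, L] ->
     `|kappa s' - kappa s| <= eta) ->
  (forall eta : R, 0 < eta -> \forall s' \near s, s' \in `[0, L] ->
     forall t : R, t \in `[-1, 1] -> `|Keps (s', t) - Keps (s, t)| <= eta) ->
  strip L (s, t) -> {for (s, t), continuous f}.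
Proof.
move=> ck cK [/= s0L t1].
have sL : s \in `[0, L] by exact: subset_itv_oo_cc.
have [f' [d1 d2 f0 f'0]] := jacobi_derive sL.
have /andP[e2M0 e2M] := eps2M; have eM := epsM; have [e0 m0] := (eps_gt0, M_gt0).
have n1 : `|1 : R| <= 1 by rewrite normr1.
have e1 : eps <= 1 by have := eps_half; lra.
have e21 : eps ^+ 2 <= 1 by rewrite expr_le1// ltW.
have a1 : eps ^+ 2 * M <= 1 / 2 by lra.
apply/cvgrPdist_le => e e_gt0.
(* The initial slopes differ by at most [eta] and the forcing is at most [2 * eta], because
   [|f| <= 2]; the resulting [6 * eta] is half of [e]. *)
pose eta := e / 12.
have eta0 : 0 < eta by rewrite divr_gt0.
have eta2 : 2 * (0 + eta + 2 * eta) + e / 2 = e by rewrite /eta; field.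
have nt : \forall t' \near t, `|f (s, t) - f (s, t')| <= e / 2.
  have /is_derive_continuous/cvgrPdist_le := d1 _ t1.
  by apply; rewrite divr_gt0.
have nt1 : \forall t' \near t, t' \in `]-1, 1[ by exact: near_in_itvoo.
have ns1 : \forall s' \near s, s' \in `[0, L].
  by move/near_in_itvoo : s0L; apply: filterS => u; exact: subset_itv_oo_cc.
have ns : \forall s' \near s, forall t' : R, t' \in `]-1, 1[ ->
    `|f (s', t') - f (s, t')| <= 2 * (0 + eta + 2 * eta).
  near=> s' => t' t'1.
  have s'L : s' \in `[0, L] by near: s'.
  have kk : `|kappa s' - kappa s| <= eta.
    by move: s'L; near: s'; exact: ck.
  have KK (u : R) : u \in `[-1, 1] -> `|Keps (s', u) - Keps (s, u)| <= eta.
    by move: u; move: s'L; near: s'; exact: cK.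
  have [g' [dg1 dg2 g0 g'0]] := jacobi_derive s'L.
  have D1 (u : R) : u \in `]-1, 1[ -> is_derive u 1 (fun t => f (s', t) - f (s, t)) (g' u - f' u).
    by move=> u1; apply: is_deriveB; [exact: dg1|exact: d1].
  have D2 (u : R) : u \in `]-1, 1[ -> is_derive u 1 (fun u => g' u - f' u)
     (- (eps ^+ 2 * Keps (s', u) * f (s', u)) - - (eps ^+ 2 * Keps (s, u) * f (s, u))).
    by move=> u1; apply: is_deriveB; [exact: dg2|exact: d2].
  have bnd (u : R) : u \in `]-1, 1[ ->
    `|- (eps ^+ 2 * Keps (s', u) * f (s', u)) - - (eps ^+ 2 * Keps (s, u) * f (s, u))|
    <= eps ^+ 2 * M * `|f (s', u) - f (s, u)| + 2 * eta.
    move=> u1; have u1' : u \in `[-1, 1] by exact: subset_itv_oo_cc.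
    have -> : - (eps ^+ 2 * Keps (s', u) * f (s', u)) - - (eps ^+ 2 * Keps (s, u) * f (s, u))
      = - (eps ^+ 2 * Keps (s', u) * (f (s', u) - f (s, u))
           + eps ^+ 2 * (f (s, u) * (Keps (s', u) - Keps (s, u)))) by ring.
    rewrite normrN; apply: le_trans (ler_normD _ _) _; apply: lerD.
      rewrite 2!normrM [`|eps ^+ 2|]ger0_norm ?sqr_ge0//.
      by rewrite ler_wpM2r// ler_wpM2l ?sqr_ge0// Keps_bound.
    rewrite normrM [X in _ * X]normrM [`|eps ^+ 2|]ger0_norm ?sqr_ge0//.
    apply: (@le_trans _ _ (1 * (`|f (s, u)| * `|Keps (s', u) - Keps (s, u)|))).
      by rewrite ler_wpM2r// mulr_ge0.
    rewrite mul1r; apply: ler_pM => //; last exact: KK.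
    apply: (norm_triangle_le (jacobi_near_one sL u1) n1).
    by move: eM; lra.
  have := second_order_bound (q := 0) (p := eta) D1 D2 bnd.
  rewrite f0 g0 subrr normr0 => /(_ (lexx _)); apply => //; last first.
    by rewrite mulr_ge0// ltW.
  rewrite f'0 g'0 (_ : _ - _ = - (eps * (kappa s' - kappa s))); last by ring.
  by rewrite normrN normrM (gtr0_norm e0) -[leRHS]mul1r ler_pM// ltW.
near=> x.
rewrite [x]surjective_pairing.
have h1 : x.2 \in `]-1, 1[ by near: x; apply: (cvg_snd nt1).
have h2 : `|f (s, x.2) - f (x.1, x.2)| <= 2 * (0 + eta + 2 * eta).
  by rewrite distrC; move: (x.2) h1; near: x; apply: (cvg_fst ns).
have h3 : `|f (s, t) - f (s, x.2)| <= e / 2 by near: x; apply: (cvg_snd nt).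
by apply: (dist_triangle_le h3 h2); rewrite addrC eta2.
Unshelve. all: by end_near. Qed.

End Jacobi.

(** * Weak resolvent equations *)

Section ComplexDot.
Local Open Scope complex_scope.
Context {R : realType}.
Implicit Types (z w : R[i]) (c : R).

(** The real part of [z * w^*], that is, the Euclidean inner product of the plane. *)
Definition cdot z w : R := complex.Re z * complex.Re w + complex.Im z * complex.Im w.

Lemma Re_weighted_mul c z w : complex.Re (c%:C * z * w^*) = c * cdot z w.
Proof. by case: z w => [a b] [a' b']; rewrite /cdot /=; ring. Qed.

Lemma complex_ReD z w : complex.Re (z + w) = complex.Re z + complex.Re w.
Proof. by case: z w => [a b] [a' b']. Qed.

Lemma normc_sqr z : Normc.normc z ^+ 2 = cdot z z.
Proof. by case: z => a b; rewrite /cdot /= sqr_sqrtr ?addr_ge0 ?sqr_ge0// !expr2. Qed.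

Lemma cdot_ge0 z : 0 <= cdot z z.
Proof. by rewrite -normc_sqr sqr_ge0. Qed.

Lemma cdot_le z w : `|cdot z w| <= cdot z z + cdot w w.
Proof.
case: z w => [a b] [a' b']; rewrite /cdot /= ler_norml.
have [? ? ?] := And3 (sqr_ge0 (a + a')) (sqr_ge0 (a - a')) (sqr_ge0 a).
have [? ? ?] := And3 (sqr_ge0 (b + b')) (sqr_ge0 (b - b')) (sqr_ge0 b).
have [? ?] := (sqr_ge0 a', sqr_ge0 b').
by apply/andP; split; lra.
Qed.

Lemma cdotBl z z' w : cdot (z - z') w = cdot z w - cdot z' w.
Proof. by case: z z' w => [a b] [a' b'] [a'' b'']; rewrite /cdot /=; ring. Qed.

End ComplexDot.

(** * Square-integrable functions and real parts of the forms *)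

Section StripL2.
Local Open Scope complex_scope.
Context {R : realType}.
Variable L : R.
Local Notation S := (strip L).
Local Notation mu := (@lebesgue_measure R \x @lebesgue_measure R)%E.
Implicit Types (w a b : R * R -> R) (u v g : R * R -> R[i]).

(* [R] carries two convertible measurable structures with different displays;
   [lebesgue_measure] lives on the one of [measurableTypeR]. *)
Let measurable_strip :
  @measurable _ (measurableTypeR R * measurableTypeR R)%type S.
Proof. exact: strip_measurable. Qed.

Definition sintegrable (h : R * R -> R) := mu.-integrable S (EFin \o h).

Lemma sintegrableD h k : sintegrable h -> sintegrable k ->
  sintegrable (fun x => h x + k x).
Proof.
move=> ih ik; apply: eq_integrable (integrableD measurable_strip ih ik) => //.
Qed.

Lemma sintegrableB h k : sintegrable h -> sintegrable k ->
  sintegrable (fun x => h x - k x).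
Proof.
move=> ih ik; apply: eq_integrable (integrableB measurable_strip ih ik) => //.
Qed.

Lemma sintegrableZ c h : sintegrable h -> sintegrable (fun x => c * h x).
Proof.
move=> ih; apply: eq_integrable (integrableZl measurable_strip c ih) => //.
Qed.

Definition bounded_weight w :=
  measurable_fun S w /\ exists B, forall x, S x -> `|w x| <= B.

Lemma L2norm_ltyP w u : (forall x, S x -> 0 <= w x) ->
  ((\int[mu]_(x in S) (w x * cdot (u x) (u x))%:E < +oo) <-> (L2norm L w u < +oo))%E.
Proof.
move=> w0; rewrite /L2norm.
under [X in (X `^ _)%E]eq_integral do rewrite normc_sqr.
split; first exact: poweR_lty.
by apply: lty_poweRy; rewrite invr_eq0.
Qed.

Lemma measurable_cdot u v :
  measurable_fun S (fun x => complex.Re (u x)) ->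
  measurable_fun S (fun x => complex.Im (u x)) ->
  measurable_fun S (fun x => complex.Re (v x)) ->
  measurable_fun S (fun x => complex.Im (v x)) ->
  measurable_fun S (fun x => cdot (u x) (v x)).
Proof. by move=> *; apply: measurable_funD; exact: measurable_funM. Qed.

Lemma L2_unitP u : L2 L unit_weight u <->
  [/\ measurable_fun S (fun x => complex.Re (u x)),
      measurable_fun S (fun x => complex.Im (u x)) &
      mu.-integrable S (EFin \o (fun x => cdot (u x) (u x)))].
Proof.
have E : (\int[mu]_(x in S) (unit_weight x * cdot (u x) (u x))%:E =
    \int[mu]_(x in S) `|(cdot (u x) (u x))%:E|)%E.
  by apply: eq_integral => x _; rewrite mul1r gee0_abs// lee_fin cdot_ge0.
split=> [] [mr mi h]; split=> //.
  apply/integrableP; split.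
    by apply/measurable_EFinP; exact: measurable_cdot.
  rewrite -E; exact/(L2norm_ltyP (w := unit_weight)).
apply/L2norm_ltyP => //; rewrite E.
by case/integrableP : h.
Qed.

Lemma integrable_weighted_cdot w u v : bounded_weight w ->
  L2 L unit_weight u -> L2 L unit_weight v ->
  sintegrable (fun x => w x * cdot (u x) (v x)).
Proof.
move=> [mw [B wB]] /L2_unitP[mru miu iu] /L2_unitP[mrv miv iv].
have mS := measurable_strip.
have ig : mu.-integrable S (fun x => B%:E * ((cdot (u x) (u x))%:E + (cdot (v x) (v x))%:E))%E.
  by apply: integrableZl => //; exact: integrableD.
apply: le_integrable ig => //.
  by apply/measurable_EFinP; apply: measurable_funM => //; exact: measurable_cdot.
move=> x Sx /=; rewrite lee_fin [leLHS]normrM [leRHS]normrM; apply: ler_pM => //.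
  by rewrite (le_trans (wB _ Sx))// ler_norm.
by apply: le_trans (cdot_le _ _) (ler_norm _).
Qed.

Lemma L2_unitB u v : L2 L unit_weight u -> L2 L unit_weight v ->
  L2 L unit_weight (fun x => u x - v x).
Proof.
move=> /[dup] hu /L2_unitP[mru miu iu] /[dup] hv /L2_unitP[mrv miv iv].
have mS := measurable_strip.
apply/L2_unitP.
have mr : measurable_fun S (fun x => complex.Re (u x - v x)).
  rewrite (_ : (fun x => _) = (fun x => complex.Re (u x) - complex.Re (v x))).
    exact: measurable_funB.
  by apply/funext => x; case: (u x) (v x) => [? ?] [? ?].
have mi : measurable_fun S (fun x => complex.Im (u x - v x)).
  rewrite (_ : (fun x => _) = (fun x => complex.Im (u x) - complex.Im (v x))).
    exact: measurable_funB.
  by apply/funext => x; case: (u x) (v x) => [? ?] [? ?].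
split=> //.
have ig : mu.-integrable S (fun x => 2%:E * ((cdot (u x) (u x))%:E + (cdot (v x) (v x))%:E))%E.
  by apply: integrableZl => //; exact: integrableD.
apply: le_integrable ig => //.
  by apply/measurable_EFinP; exact: measurable_cdot.
move=> x Sx /=; rewrite lee_fin [leLHS]ger0_norm ?cdot_ge0//.
apply: le_trans (ler_norm _).
case: (u x) (v x) => [a b] [a' b']; rewrite /cdot /=.
by have [? ?] := (sqr_ge0 (a + a'), sqr_ge0 (b + b')); lra.
Qed.

Lemma L2_unitM w u : bounded_weight w -> L2 L unit_weight u ->
  L2 L unit_weight (fun x => (w x)%:C * u x).
Proof.
move=> [mw [B wB]] /[dup] hu /L2_unitP[mru miu iu].
have mS := measurable_strip.
apply/L2_unitP.
have mr : measurable_fun S (fun x => complex.Re ((w x)%:C * u x)).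
  rewrite (_ : (fun x => _) = (fun x => w x * complex.Re (u x))).
    exact: measurable_funM.
  by apply/funext => x; case: (u x) => [? ?] /=; ring.
have mi : measurable_fun S (fun x => complex.Im ((w x)%:C * u x)).
  rewrite (_ : (fun x => _) = (fun x => w x * complex.Im (u x))).
    exact: measurable_funM.
  by apply/funext => x; case: (u x) => [? ?] /=; ring.
split=> //.
have ig : mu.-integrable S (fun x => (B ^+ 2)%:E * (cdot (u x) (u x))%:E)%E.
  exact: integrableZl.
apply: le_integrable ig => //.
  by apply/measurable_EFinP; exact: measurable_cdot.
move=> x Sx /=; rewrite lee_fin [leLHS]ger0_norm ?cdot_ge0//.
apply: le_trans (ler_norm _).
have -> : cdot ((w x)%:C * u x) ((w x)%:C * u x) = w x ^+ 2 * cdot (u x) (u x).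
  by case: (u x) => [a b]; rewrite /cdot /=; ring.
rewrite ler_wpM2r ?cdot_ge0//.
have := wB x Sx; rewrite ler_norml => /andP[? ?]; nra.
Qed.

Lemma Re_inner w u v :
  complex.Re (inner L w u v) = (\int[mu]_(x in S) (w x * cdot (u x) (v x)))%R.
Proof. by apply: eq_Rintegral => x _; exact: Re_weighted_mul. Qed.

Lemma Re_form a b u v : complex.Re (form L a b u v) =
  (\int[mu]_(x in S) (a x *
     cdot (weak_derivative L (1, 0) u x) (weak_derivative L (1, 0) v x)))%R
  + (\int[mu]_(x in S) (b x *
     cdot (weak_derivative L (0, 1) u x) (weak_derivative L (0, 1) v x)))%R.
Proof.
exact: (etrans (complex_ReD _ _) (congr2 +%R (Re_inner _ _ _) (Re_inner _ _ _))).
Qed.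

Lemma W12_weak_derivative e u : (exists2 du, L2 L unit_weight du &
  is_weak_derivative L e u du) -> L2 L unit_weight (weak_derivative L e u).
Proof.
move=> [du h1 h2].
pose P := [set du | L2 L unit_weight du /\ is_weak_derivative L e u du].
by case: (xgetPex (cst 0) (ex_intro P du (conj h1 h2))).
Qed.

(** The integrand of the real part of the weak equation of [H + 1] for the solution [u], the datum
    [g] and the test function [v]. As a single density it can be combined pointwise with others
    before integration. *)
Definition form_density w a b g u v x : R :=
  a x * cdot (weak_derivative L (1, 0) u x) (weak_derivative L (1, 0) v x)
  + b x * cdot (weak_derivative L (0, 1) u x) (weak_derivative L (0, 1) v x)
  + w x * cdot (u x) (v x) - w x * cdot (g x) (v x).

Lemma resolvent_weak_equation w a b T g :
  bounded_weight w -> bounded_weight a -> bounded_weight b ->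
  is_resolvent L w (associated_operator L w (form L a b)) T ->
  L2 L w g -> L2 L unit_weight g ->
  W12 L (T g) /\ forall v, W12 L v ->
  sintegrable (form_density w a b g (T g) v) /\
  \int[mu]_(x in S) form_density w a b g (T g) v x = 0.
Proof.
move=> bw ba bb [res _] gw g1; have [eta [Wu [mre mie _] eqn] ae] := res g gw.
split=> // v Wv.
have mS := measurable_strip.
have [u1 /W12_weak_derivative us /W12_weak_derivative ut] := Wu.
have [v1 /W12_weak_derivative vs /W12_weak_derivative vt] := Wv.
have ia := integrable_weighted_cdot ba us vs.
have ib := integrable_weighted_cdot bb ut vt.
have iu := integrable_weighted_cdot bw u1 v1.
have ig := integrable_weighted_cdot bw g1 v1.
have iab : sintegrable (fun x =>
  a x * cdot (weak_derivative L (1, 0) (T g) x) (weak_derivative L (1, 0) v x)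
  + b x * cdot (weak_derivative L (0, 1) (T g) x) (weak_derivative L (0, 1) v x)).
  exact: sintegrableD.
have iabu : sintegrable (fun x =>
  a x * cdot (weak_derivative L (1, 0) (T g) x) (weak_derivative L (1, 0) v x)
  + b x * cdot (weak_derivative L (0, 1) (T g) x) (weak_derivative L (0, 1) v x)
  + w x * cdot (T g x) (v x)).
  exact: sintegrableD.
have E := etrans (esym (Re_form a b (T g) v))
  (etrans (congr1 (@complex.Re R) (eqn v Wv)) (Re_inner w eta v)).
(* [eta], the image of [T g] under the operator, equals [g - T g] only almost everywhere, so it is
   eliminated under the integral. *)
have E2 : \int[mu]_(x in S) (w x * cdot (eta x) (v x)) =
   \int[mu]_(x in S) (w x * cdot (g x) (v x)) - \int[mu]_(x in S) (w x * cdot (T g x) (v x)).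
  rewrite -RintegralB//; congr fine; apply: ae_eq_integral => //.
  - apply/measurable_EFinP; apply: measurable_funM; first by case: bw.
    by case/L2_unitP: v1 => mrv miv _; exact: measurable_cdot.
  - apply/measurable_EFinP; apply: measurable_funB.
      by case/integrableP: ig => /measurable_EFinP.
    by case/integrableP: iu => /measurable_EFinP.
  - have FF := @ae_filter_ringOfSetsType _ _ R mu.
    move: ae; apply: filterS => x h Sx.
    by rewrite -mulrBr -cdotBl -(h Sx) addrK.
split; first exact: sintegrableB.
have alg (I J A B U G H F : R) : I = J - G -> J = H + U -> H = A + B ->
    A + B = F -> F = G - U -> I = 0 by move=> -> -> -> -> ->; ring.
exact: (alg _ _ _ _ _ _ _ _ (RintegralB mS iabu ig) (RintegralD mS iab iu)
  (RintegralD mS ia ib) E E2).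
Qed.

End StripL2.

(** * Comparison of the resolvents *)

Section Pointwise.
Local Open Scope complex_scope.
Context {R : realType}.

(** Here [h] is the square root of the weight [f], [a] its inverse weight, [e] stands for
    [eps ^- 2], and [A], [B] are derivatives. The bracket with factor 4 is the difference of the two
    equations tested with [u - u0]; completing squares in it leaves errors at most
    [2 * d ^+ 2 * A ^+ 2], [d ^+ 2 * e * B ^+ 2], [6 * d ^+ 2 * u ^+ 2] and [4 * d ^+ 2 * g ^+ 2].
    The multiple 24 of the equation tested with [u] absorbs the first three at the price of
    [12 * d ^+ 2 * g ^+ 2], whence 16. *)
Lemma resolvent_pointwise_real (e a h d A A0 B B0 u u0 g : R) :
  0 <= e -> 0 <= h -> a * h ^+ 2 = 1 -> `|h ^+ 2 - 1| <= d -> d <= 1 / 4 ->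
  (h * u - u0) ^+ 2 <=
    4 * ((a * (A * A) + e * h ^+ 2 * (B * B) + h ^+ 2 * (u * u) - h * (g * u))
       - (a * (A * A0) + e * h ^+ 2 * (B * B0) + h ^+ 2 * (u * u0) - h * (g * u0))
       - ((A0 * A + e * (B0 * B) + u0 * u - g * u)
         - (A0 * A0 + e * (B0 * B0) + u0 * u0 - g * u0)))
    + 24 * d ^+ 2 * (a * (A * A) + e * h ^+ 2 * (B * B) + h ^+ 2 * (u * u) - h * (g * u))
    + 16 * d ^+ 2 * (g * g).
Proof.
move=> e0 h0 ah; rewrite ler_norml => /andP[hd1 hd2] d4.
have d0 : 0 <= d by lra.
have h34 : 3 / 4 <= h ^+ 2 by lra.
have a0 : 0 <= a.
  by rewrite -(pmulr_lge0 (x := h ^+ 2)) ?ah//; lra.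
have a43 : a <= 4 / 3.
  have : 0 <= a * (h ^+ 2 - 3 / 4) by rewrite mulr_ge0// subr_ge0.
  by rewrite mulrBr ah; lra.
have a12 : 1 / 2 <= a.
  have : 0 <= a * (2 - h ^+ 2) by rewrite mulr_ge0//; lra.
  by rewrite mulrBr ah; lra.
have D0 : 0 <= d ^+ 2 by rewrite sqr_ge0.
have q : (h ^+ 2 - 1) ^+ 2 <= d ^+ 2.
  have : 0 <= (d - (h ^+ 2 - 1)) * (d + (h ^+ 2 - 1)) by apply: mulr_ge0; lra.
  lra.
have p : (a - 1) ^+ 2 <= 2 * d ^+ 2.
  have -> : (a - 1) ^+ 2 = a ^+ 2 * (h ^+ 2 - 1) ^+ 2.
    by rewrite -exprMn mulrBr ah mulr1 -sqrrN opprB.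
  have a2 : a ^+ 2 <= 2.
    have : 0 <= (4 / 3 - a) * (4 / 3 + a) by apply: mulr_ge0; lra.
    lra.
  by apply: ler_pM => //; exact: sqr_ge0.
have k : (h - 1) ^+ 2 <= d ^+ 2.
  apply: le_trans q; rewrite (_ : h ^+ 2 - 1 = (h - 1) * (h + 1)); last by ring.
  rewrite exprMn ler_peMr ?sqr_ge0//.
  by have := sqr_ge0 h; lra.
pose P := A - A0; pose Q := B - B0; pose w := u - u0.
(* [F1] to [F4] complete the squares in the derivatives, [F5] to [F8] those in the zero-order terms;
   [F9] and [F10] pass from [u - u0] to [h * u - u0]. *)
have F1 := sqr_ge0 (2 * P + (a - 1) * A).
have F2 : (a - 1) ^+ 2 * A ^+ 2 <= 2 * d ^+ 2 * A ^+ 2 by rewrite ler_wpM2r ?sqr_ge0.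
have F3 : 0 <= e * (2 * Q + (h ^+ 2 - 1) * B) ^+ 2 := mulr_ge0 e0 (sqr_ge0 _).
have F4 : e * B ^+ 2 * (h ^+ 2 - 1) ^+ 2 <= e * B ^+ 2 * d ^+ 2.
  by rewrite ler_wpM2l//; exact: mulr_ge0 e0 (sqr_ge0 B).
have F5 := sqr_ge0 (w + ((h ^+ 2 - 1) * u - (h - 1) * g)).
have F6 := sqr_ge0 ((h ^+ 2 - 1) * u + (h - 1) * g).
have F7 : (h ^+ 2 - 1) ^+ 2 * u ^+ 2 <= d ^+ 2 * u ^+ 2 by rewrite ler_wpM2r ?sqr_ge0.
have F8 : (h - 1) ^+ 2 * g ^+ 2 <= d ^+ 2 * g ^+ 2 by rewrite ler_wpM2r ?sqr_ge0.
have F9 := sqr_ge0 (w - (h - 1) * u).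
have F10 : (h - 1) ^+ 2 * u ^+ 2 <= d ^+ 2 * u ^+ 2 by rewrite ler_wpM2r ?sqr_ge0.
have M2 (x y : R) : 0 <= x -> 0 <= x * y ^+ 2.
  by move=> x0; exact: mulr_ge0 x0 (sqr_ge0 y).
have a12' : 0 <= a - 1 / 2 by rewrite subr_ge0.
have h34' : 0 <= h ^+ 2 - 3 / 4 by rewrite subr_ge0.
(* Coercivity of the weighted energy; [G3] bounds [h * (g * u)] by half the sum of the squares of
   [h * u] and [g]. *)
have G1 : 0 <= d ^+ 2 * ((a - 1 / 2) * A ^+ 2) := mulr_ge0 D0 (M2 _ A a12').
have G2 : 0 <= d ^+ 2 * (e * ((h ^+ 2 - 3 / 4) * B ^+ 2)) :=
  mulr_ge0 D0 (mulr_ge0 e0 (M2 _ B h34')).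
have G3 : 0 <= d ^+ 2 * (h * u - g) ^+ 2 := M2 _ _ D0.
have G4 : 0 <= d ^+ 2 * ((h ^+ 2 - 3 / 4) * u ^+ 2) := mulr_ge0 D0 (M2 _ u h34').
have G5 : 0 <= d ^+ 2 * A ^+ 2 := M2 _ A D0.
have G6 : 0 <= d ^+ 2 * (e * B ^+ 2) := mulr_ge0 D0 (M2 _ B e0).
have G7 : 0 <= d ^+ 2 * u ^+ 2 := M2 _ u D0.
rewrite /P /Q /w in F1 F3 F5 F9.
clear a12' h34' M2 hd1 hd2 d4 d0 h34 a0 a43 a12 D0 q p k ah e0 h0 P Q w.
lra.
Qed.

Lemma resolvent_pointwise (e a h d : R) (A A0 B B0 u u0 g : R[i]) :
  0 <= e -> 0 <= h -> a * h ^+ 2 = 1 -> `|h ^+ 2 - 1| <= d -> d <= 1 / 4 ->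
  cdot (h%:C * u - u0) (h%:C * u - u0) <=
    4 * ((a * cdot A A + e * h ^+ 2 * cdot B B + h ^+ 2 * cdot u u - h * cdot g u)
       - (a * cdot A A0 + e * h ^+ 2 * cdot B B0 + h ^+ 2 * cdot u u0 - h * cdot g u0)
       - ((cdot A0 A + e * cdot B0 B + cdot u0 u - cdot g u)
         - (cdot A0 A0 + e * cdot B0 B0 + cdot u0 u0 - cdot g u0)))
    + 24 * d ^+ 2 * (a * cdot A A + e * h ^+ 2 * cdot B B + h ^+ 2 * cdot u u - h * cdot g u)
    + 16 * d ^+ 2 * cdot g g.
Proof.
move=> e0 h0 ah hd d4.
case: A A0 B B0 u u0 g => [Ar Ai] [A0r A0i] [Br Bi] [B0r B0i] [ur ui] [u0r u0i] [gr gi].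
have H := lerD (resolvent_pointwise_real Ar A0r Br B0r ur u0r gr e0 h0 ah hd d4)
  (resolvent_pointwise_real Ai A0i Bi B0i ui u0i gi e0 h0 ah hd d4).
set lhs := (X in X <= _) in H; set rhs := (X in _ <= X) in H.
have <- : lhs = cdot (h%:C * (ur +i* ui) - (u0r +i* u0i)) (h%:C * (ur +i* ui) - (u0r +i* u0i)).
  by rewrite /lhs /cdot /=; ring.
apply: le_trans H _; rewrite le_eqVlt; apply/orP; left; apply/eqP.
by rewrite /rhs /cdot /=; ring.
Qed.

End Pointwise.

(** * Integration of the pointwise inequality *)

Section ResolventComparison.
Local Open Scope complex_scope.
Context {R : realType}.
Variables (L eps d : R) (f : R * R -> R).
Hypothesis f_continuous : forall x, strip L x -> {for x, continuous f}.
Hypothesis f_near1 : forall x, strip L x -> `|f x - 1| <= d.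
Hypothesis d_le : d <= 1 / 4.
Hypothesis d_ge0 : 0 <= d.
Local Notation S := (strip L).
Local Notation mu := (@lebesgue_measure R \x @lebesgue_measure R)%E.
Implicit Types (g u : R * R -> R[i]) (T : (R * R -> R[i]) -> R * R -> R[i]).

Lemma f_range x : S x -> 3 / 4 <= f x <= 5 / 4.
Proof.
move=> /f_near1; rewrite ler_norml => /andP[? ?]; have := d_le => ?.
by apply/andP; split; lra.
Qed.

Lemma f_gt0 x : S x -> 0 < f x.
Proof. by move=> /f_range/andP[? _]; lra. Qed.

Lemma bounded_weight_cst (c : R) : bounded_weight L (fun=> c).
Proof. by split; [exact: measurable_cst|exists `|c|]. Qed.

Lemma bounded_weight_f : bounded_weight L f.
Proof.
split; first by apply: continuous_measurable_plane => //; exact: strip_open.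
by exists 2 => x /[dup] /f_gt0 h /f_range/andP[_ ?]; rewrite gtr0_norm//; lra.
Qed.

Lemma bounded_weightZ c w : bounded_weight L w -> bounded_weight L (fun x => c * w x).
Proof.
move=> [mw [B wB]]; split; first by apply: measurable_funM => //; exact: measurable_cst.
by exists (`|c| * B) => x Sx; rewrite normrM ler_wpM2l// wB.
Qed.

Lemma inv_f_le x : S x -> (f x)^-1 <= 4 / 3.
Proof.
move=> /[dup] Sx /f_range/andP[? _].
by rewrite -[leRHS]invrK lef_pV2 ?posrE ?invr_gt0 ?f_gt0//; lra.
Qed.

Lemma bounded_weight_inv_f : bounded_weight L (fun x => (f x)^-1).
Proof.
split.
  apply: continuous_measurable_plane => [|x Sx]; first exact: strip_open.
  by apply: continuousV; [rewrite gt_eqF// f_gt0|exact: f_continuous].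
by exists (4 / 3) => x Sx; rewrite gtr0_norm ?invr_gt0 ?f_gt0// inv_f_le.
Qed.

Lemma bounded_weight_sqrt_f : bounded_weight L (fun x => Num.sqrt (f x)).
Proof.
split.
  apply: continuous_measurable_plane => [|x Sx]; first exact: strip_open.
  exact: continuous_comp (f_continuous Sx) (@sqrt_continuous _ _).
exists 2 => x Sx; rewrite ger0_norm ?sqrtr_ge0//.
rewrite -(@ler_pXn2r _ 2)// ?nnegrE ?sqrtr_ge0// sqr_sqrtr ?(ltW (f_gt0 Sx))//.
by have /andP[_ ?] := f_range Sx; lra.
Qed.

Lemma bounded_weight_inv_sqrt_f : bounded_weight L (fun x => (Num.sqrt (f x))^-1).
Proof.
split.
  apply: continuous_measurable_plane => [|x Sx]; first exact: strip_open.
  apply: continuousV; first by rewrite gt_eqF// sqrtr_gt0 f_gt0.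
  exact: continuous_comp (f_continuous Sx) (@sqrt_continuous _ _).
exists 2 => x Sx; rewrite ger0_norm ?invr_ge0 ?sqrtr_ge0//.
rewrite -(@ler_pXn2r _ 2)// ?nnegrE ?invr_ge0 ?sqrtr_ge0// exprVn.
rewrite sqr_sqrtr ?(ltW (f_gt0 Sx))// (le_trans (inv_f_le Sx))//.
lra.
Qed.

Lemma cdotZl (c : R) (z w : R[i]) : cdot (c%:C * z) w = c * cdot z w.
Proof. by case: z w => [a b] [a' b']; rewrite /cdot /=; ring. Qed.

Lemma L2_Uinv g : L2 L unit_weight g -> L2 L unit_weight (Uinv f g).
Proof. by move=> g2; exact: L2_unitM bounded_weight_inv_sqrt_f g2. Qed.

Lemma L2_weighted w g : bounded_weight L w -> (forall x, S x -> 0 <= w x) ->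
  L2 L unit_weight g -> L2 L w g.
Proof.
move=> bw w0 g2; have [mr mi _] := g2; split=> //; apply/L2norm_ltyP => //.
have /integrableP[_] := integrable_weighted_cdot bw g2 g2.
apply: le_lt_trans; rewrite le_eqVlt; apply/orP; left; apply/eqP.
apply: eq_integral => x; rewrite inE => Sx /=; rewrite ger0_norm//.
by rewrite mulr_ge0 ?w0 ?cdot_ge0.
Qed.

Lemma L2norm_unitE g : L2 L unit_weight g ->
  L2norm L unit_weight g =
    (Num.sqrt (\int[mu]_(x in S) cdot (g x) (g x)))%:E.
Proof.
move=> /L2_unitP[_ _ ig]; rewrite /L2norm.
under eq_integral do rewrite mul1r normc_sqr.
have fin := integrable_fin_num (strip_measurable L : @measurable _
  (measurableTypeR R * measurableTypeR R)%type S) ig.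
rewrite -(fineK fin) poweR_EFin powR12_sqrt//.
by apply: Rintegral_ge0 => x _; exact: cdot_ge0.
Qed.

(** The densities of the four tested weak equations integrate to zero. Of the pointwise majorant
    only [16 * d ^+ 2] times the squared norm of [g] remains, and its square root is at most
    [4 * d]. *)
Lemma resolvent_comparison Teps T0 :
  is_resolvent L f (associated_operator L f (form_eps L eps f)) Teps ->
  is_resolvent L unit_weight (associated_operator L unit_weight (form_0 L eps)) T0 ->
  (opnorm L (fun g x => (Uop f (Teps (Uinv f g)) x - T0 g x)%R) <= (4 * d)%:E)%E.
Proof.
move=> re r0; apply: ge_ereal_sup => _ [g [g2 g1] <-].
have mS : @measurable _ (measurableTypeR R * measurableTypeR R)%type S.
  exact: strip_measurable.
have gi := L2_Uinv g2.
have gif : L2 L f (Uinv f g).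
  by apply: L2_weighted => //; [exact: bounded_weight_f|move=> x /f_gt0/ltW].
have [Wu eqe] := resolvent_weak_equation bounded_weight_f bounded_weight_inv_f
  (bounded_weightZ (eps ^- 2) bounded_weight_f) re gif gi.
have [W0 eq0] := resolvent_weak_equation (bounded_weight_cst 1) (bounded_weight_cst 1)
  (bounded_weight_cst (eps ^- 2)) r0 g2 g2.
set u := Teps (Uinv f g) in Wu eqe *; set u0 := T0 g in W0 eq0 *.
have [i1 I1] := eqe _ Wu; have [i2 I2] := eqe _ W0.
have [i3 I3] := eq0 _ Wu; have [i4 I4] := eq0 _ W0.
pose E1 v := form_density L f (fun x => (f x)^-1) (fun x => eps ^- 2 * f x) (Uinv f g) u v.
pose E2 v := form_density L (fun=> 1) (fun=> 1) (fun=> eps ^- 2) g u0 v.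
have {}i1 : sintegrable L (E1 u) := i1.
have {}i2 : sintegrable L (E1 u0) := i2.
have {}i3 : sintegrable L (E2 u) := i3.
have {}i4 : sintegrable L (E2 u0) := i4.
have {}I1 : \int[mu]_(x in S) E1 u x = 0 := I1.
have {}I2 : \int[mu]_(x in S) E1 u0 x = 0 := I2.
have {}I3 : \int[mu]_(x in S) E2 u x = 0 := I3.
have {}I4 : \int[mu]_(x in S) E2 u0 x = 0 := I4.
pose Phi x := (E1 u x - E1 u0 x) - (E2 u x - E2 u0 x).
pose G := \int[mu]_(x in S) cdot (g x) (g x).
have i12 : sintegrable L (fun x => E1 u x - E1 u0 x) := sintegrableB i1 i2.
have i34 : sintegrable L (fun x => E2 u x - E2 u0 x) := sintegrableB i3 i4.
have iPhi : sintegrable L Phi := sintegrableB i12 i34.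
have IPhi : \int[mu]_(x in S) Phi x = 0.
  rewrite (RintegralB mS i12 i34) (RintegralB mS i1 i2) (RintegralB mS i3 i4).
  by rewrite I1 I2 I3 I4 !subr0.
have [u1 _ _] := Wu; have [u01 _ _] := W0.
have diff2 : L2 L unit_weight (fun x => Uop f u x - u0 x).
  exact: L2_unitB (L2_unitM bounded_weight_sqrt_f u1) u01.
have [_ _ ig] := (L2_unitP L g).1 g2.
have [_ _ idiff] := (L2_unitP _ _).1 diff2.
rewrite (L2norm_unitE diff2) lee_fin.
have G1 : G <= 1.
  move: g1; rewrite (L2norm_unitE g2) lee_fin -/G => h.
  have G0 : 0 <= G by apply: Rintegral_ge0 => x _; exact: cdot_ge0.
  by rewrite -(sqr_sqrtr G0) expr_le1// sqrtr_ge0.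
have a1 := sintegrableZ 4 iPhi.
have a2 := sintegrableZ (24 * d ^+ 2) i1.
have a3 := sintegrableZ (16 * d ^+ 2) ig.
have a12 := sintegrableD a1 a2.
have key : \int[mu]_(x in S) cdot (Uop f u x - u0 x) (Uop f u x - u0 x) <=
   \int[mu]_(x in S) (4 * Phi x + 24 * d ^+ 2 * E1 u x + 16 * d ^+ 2 * cdot (g x) (g x)).
  apply: (le_Rintegral mS idiff (sintegrableD a12 a3)) => x Sx.
  have f0 := f_gt0 Sx.
  have hh : Num.sqrt (f x) ^+ 2 = f x by rewrite sqr_sqrtr// ltW.
  have ah : (f x)^-1 * Num.sqrt (f x) ^+ 2 = 1 by rewrite hh mulVf// gt_eqF.
  have hd : `|Num.sqrt (f x) ^+ 2 - 1| <= d by rewrite hh f_near1.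
  have e0 : 0 <= eps ^- 2 by rewrite invr_ge0 sqr_ge0.
  have D1 v : E1 v x = (f x)^-1 *
      cdot (weak_derivative L (1, 0) u x) (weak_derivative L (1, 0) v x)
      + eps ^- 2 * Num.sqrt (f x) ^+ 2 *
      cdot (weak_derivative L (0, 1) u x) (weak_derivative L (0, 1) v x)
      + Num.sqrt (f x) ^+ 2 * cdot (u x) (v x) - Num.sqrt (f x) * cdot (g x) (v x).
    rewrite hh /E1 /form_density; congr (_ - _).
    (* The weight [f] against [Uinv f g] leaves one factor [Num.sqrt (f x)] on [g]. *)
    rewrite cdotZl mulrA; congr (_ * _); rewrite -{1}hh expr2 mulfK// gt_eqF//.
    by rewrite sqrtr_gt0.
  have D2 v : E2 v x =
      cdot (weak_derivative L (1, 0) u0 x) (weak_derivative L (1, 0) v x)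
      + eps ^- 2 *
      cdot (weak_derivative L (0, 1) u0 x) (weak_derivative L (0, 1) v x)
      + cdot (u0 x) (v x) - cdot (g x) (v x).
    by rewrite /E2 /form_density !mul1r.
  rewrite /Phi !D1 !D2.
  exact: (resolvent_pointwise (weak_derivative L (1, 0) u x)
    (weak_derivative L (1, 0) u0 x) (weak_derivative L (0, 1) u x)
    (weak_derivative L (0, 1) u0 x) (u x) (u0 x) (g x) e0 (sqrtr_ge0 _) ah hd d_le).
have I : \int[mu]_(x in S) (4 * Phi x + 24 * d ^+ 2 * E1 u x + 16 * d ^+ 2 * cdot (g x) (g x))
   = 16 * d ^+ 2 * G.
  rewrite (RintegralD mS a12 a3) (RintegralD mS a1 a2) (RintegralZl 4 mS iPhi).
  rewrite (RintegralZl _ mS i1) (RintegralZl _ mS ig) IPhi I1.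
  by rewrite !mulr0 !add0r.
rewrite I in key.
have d0 : 0 <= 4 * d by rewrite mulr_ge0.
rewrite -[leRHS]ger0_norm// -sqrtr_sqr ler_wsqrtr//.
apply: le_trans key _; rewrite exprMn (_ : 4 ^+ 2 = 16); last by ring.
by rewrite ler_piMr// mulr_ge0// sqr_ge0.
Qed.

End ResolventComparison.

Theorem theorem1p4 (R : realType) (A : oriented_surface R) (K : A -> R)
    (L : R) (Gam : R -> A) (N : R -> @tangent R A) (kappa : R -> R)
    (HK : is_gauss_curvature K) (HL : 0 < L)
    (HGam : unit_speed_embedded L Gam)
    (HN : is_unit_normal L Gam N)
    (Hkappa : is_curvature L Gam N kappa) :
  exists C eps0 : R, [/\ 0 < C, 0 < eps0 &
    forall eps : R, 0 < eps -> eps < eps0 ->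
    forall (Leps : R * R -> A) (f : R * R -> R),
    is_strip_map L Gam N eps Leps ->
    is_jacobi_solution L eps kappa (K \o Leps) f ->
    (exists2 c : R, 0 < c & forall x, strip L x -> c <= f x) /\
    forall Teps T0 : (R * R -> R[i]) -> (R * R -> R[i]),
    is_resolvent L f (associated_operator L f (form_eps L eps f)) Teps ->
    is_resolvent L unit_weight
      (associated_operator L unit_weight (form_0 L eps)) T0 ->
    (opnorm L (fun g x => (Uop f (Teps (Uinv f g)) x - T0 g x)%R)
       <= (C * eps)%:E)%E].
Proof.
have [M M0 bounds] := uniform_strip_bounds HK HGam HN Hkappa.
(* With [d = 4 * M * eps] the comparison bound [4 * d] is [16 * M * eps]; the second entry of the
   minimum makes [eps * M <= 1 / 16], hence [d <= 1 / 4]. *)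
exists (16 * M), (Num.min (1 / 2) (1 / (16 * M))).
split; first by rewrite mulr_gt0.
  by rewrite lt_min !divr_gt0// mulr_gt0.
move=> eps eps0; rewrite lt_min => /andP[/ltW eps2].
rewrite ltr_pdivlMr ?mulr_gt0// => /ltW eps16 Leps f strip_map jac.
have epsM : eps * M <= 1 / 16 by lra.
have epsM1 : eps * M <= 1 by lra.
have kb s : s \in `[0, L] -> `|kappa s| <= M by move=> /bounds[].
have Kb s t : s \in `[0, L] -> t \in `[-1, 1] -> `|(K \o Leps) (s, t)| <= M.
  by move=> /bounds[_ _ /(_ _ eps0 epsM1 _ strip_map)[+ _]]; apply.
have near1 x : strip L x -> `|f x - 1| <= 4 * M * eps.
  case: x => s t [/= sL t1].
  apply: (jacobi_near_one M0 eps0 eps2 epsM kb Kb jac) => //.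
  exact: subset_itv_oo_cc.
have cf x : strip L x -> {for x, continuous f}.
  case: x => s t st; have sL : s \in `[0, L] by case: st => /= h _; exact: subset_itv_oo_cc.
  have [_ ck /(_ _ eps0 epsM1 _ strip_map)[_ cK]] := bounds s sL.
  exact: (jacobi_continuous M0 eps0 eps2 epsM kb Kb jac ck cK st).
have d4 : 4 * M * eps <= 1 / 4 by lra.
have d0 : 0 <= 4 * M * eps by rewrite !mulr_ge0// ltW.
split.
  by exists (3 / 4) => // x /(f_range near1 d4)/andP[].
move=> Teps T0 re r0.
have -> : 16 * M * eps = 4 * (4 * M * eps) by ring.
exact: (resolvent_comparison cf near1 d4 d0 re r0).
Qed.
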